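(* Let $K\subseteq\mathbb{R}^{n+m}$ be non-empty, closed and convex, and let $\mathbf{f}:K\to\mathbb{R}^{n+m}$ be $C^1$ and satisfy $$(\mathbf{f}(\mathbf{z})-\mathbf{f}(\mathbf{w}))^T(\mathbf{z}-\mathbf{w})\le 0\quad\text{for all }\mathbf{z},\mathbf{w}\in K.$$ Let $(\phi,K,d)$ be the semi-flow of Carathéodory solutions of $$\dot{\mathbf{z}}=\mathbf{f}(\mathbf{z})-\mathbf{P}_{N_K(\mathbf{z})}(\mathbf{f}(\mathbf{z})),$$ and assume that $(\phi,K,d)$ has an equilibrium point. Let $\Omega$ be the $\omega$-limit set of $(\phi,K,d)$. Then $(\phi,\Omega,d)$ defines a flow of isometries given by solutions to the following differential equation, which has a $C^1$ vector field: $$\dot{\mathbf{z}}=\mathbf{f}(\mathbf{z})-\mathbf{P}_{N_V}(\mathbf{f}(\mathbf{z})),$$ where $V$ is the affine span of the (unique) minimal face of $K$ that contains the set of equilibrium points of the semi-flow $(\phi,K,d)$.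
   Context: $d$ is the Euclidean metric. For a closed convex set $K$ and $\mathbf{z}\in K$, the normal cone is $N_K(\mathbf{z})=\{\mathbf{w}:\mathbf{w}^T(\mathbf{z}'-\mathbf{z})\le0\ \forall \mathbf{z}'\in K\}$; when $V$ is an affine subspace, $N_V(\mathbf{z})$ does not depend on $\mathbf{z}\in V$ and is denoted $N_V$. $\mathbf{P}_C$ denotes Euclidean projection onto the non-empty closed convex set $C$. A Carathéodory solution of $\dot{\mathbf{z}}=\mathbf{g}(\mathbf{z})$ is an absolutely continuous $\mathbf{z}(t)$ such that for almost all $t$ the derivative exists and equals $\mathbf{g}(\mathbf{z}(t))$. A flow (resp. semi-flow) $(\phi,X,\rho)$ consists of a metric space $(X,\rho)$ and a continuous map $\phi:\mathbb{R}\times X\to X$ (resp. $\phi:\mathbb{R}_+\times X\to X$) with $\phi(0,x)=x$ and $\phi(t+s,x)=\phi(t,\phi(s,x))$ for all $x\in X$ and all $t,s\in\mathbb{R}$ (resp. $\mathbb{R}_+$). The $\omega$-limit set of a semi-flow is $\Omega(\phi,X,\rho)=\bigcup_{x\in X}\bigcap_{t\ge0}\overline{\phi([t,\infty),x)}$ (closure in $(X,\rho)$). For a set $A\subseteq X$ positively invariant under $\phi$, $(\phi,A,\rho)$ denotes the restriction of $\phi$ to $A$. A flow of isometries is a flow such that $\phi(t,\cdot):X\to X$ is an isometry for every $t\in\mathbb{R}$. Saying that the semi-flow $(\phi,\Omega,d)$ ''defines a flow'' means that each $\phi(t,\cdot):\Omega\to\Omega$, $t\ge0$, is invertible and one sets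 $\phi(-t,\cdot)=\phi(t,\cdot)^{-1}$ on $\Omega$. A face of a non-empty closed convex set $K$ is a convex subset $F\subseteq K$ such that every line segment $L\subseteq K$ with $(\operatorname{relint}L)\cap F\neq\emptyset$ satisfies $L\subseteq F$ ($\emptyset$ and $K$ are faces). The minimal face containing $A\subseteq K$ is the intersection of all faces of $K$ containing $A$, which is a face. *)

(* Defs.v *)
From HB Require Import structures.
From mathcomp Require Import all_boot all_order all_algebra.
From mathcomp Require Import all_classical all_reals all_analysis.
From mathcomp Require Import ring.

Set Implicit Arguments.
Unset Strict Implicit.
Unset Printing Implicit Defensive.

Import Order.TTheory GRing.Theory Num.Theory.
Import numFieldNormedType.Exports.

Local Open Scope classical_set_scope.
Local Open Scope ring_scope.

(* Points of R^N are row vectors.  The norm that the library puts on 'rV[R]_N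
   is the sup norm, so the Euclidean metric is defined here.  Both metrics
   induce the same topology, hence the library notions of open, closed,
   closure, continuity and derivative are the Euclidean ones. *)

Section Euclidean.
Context {R : realType} {N : nat}.
Implicit Types (x y z w : 'rV[R]_N) (A C F K V X : set 'rV[R]_N).

Definition dot x y : R := (x *m y^T) 0 0.

Definition eucl_norm x : R := Num.sqrt (dot x x).

Definition eucl_dist x y : R := eucl_norm (x - y).

(* Meaningful when C is non-empty, closed and convex: the nearest point then
   exists and is unique. *)
Definition proj C x : 'rV[R]_N :=
  get [set p | C p /\ forall q, C q -> eucl_dist x p <= eucl_dist x q].

Definition normal_cone K z : set 'rV[R]_N :=
  [set w | forall z', K z' -> dot w (z' - z) <= 0].

Definition affine_set V : Prop :=
  forall x y (t : R), V x -> V y -> V ((1 - t) *: x + t *: y).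

Definition affine_span A : set 'rV[R]_N :=
  \bigcap_(V in [set V | affine_set V /\ A `<=` V]) V.

(* For a non-empty affine set V, the common value N_V of the normal cones
   N_V(z), z in V; see normal_cone_affE. *)
Definition normal_cone_aff V : set 'rV[R]_N :=
  \bigcup_(z in V) normal_cone V z.

Lemma normal_cone_affE V z :
  affine_set V -> V z -> normal_cone_aff V = normal_cone V z.
Proof.
move=> affV Vz; apply/seteqP; split => [w [z0 Vz0 wz0] z' Vz'|w wz]; last first.
  by exists z.
have Vm := affV _ _ 2^-1 Vz0 Vz'.
have := wz0 _ (affV _ _ 2 Vz Vm); congr (dot w _ <= 0).
by apply/rowP => i; rewrite !mxE; field.
Qed.

Definition segment x y : set 'rV[R]_N :=
  [set (1 - t) *: x + t *: y | t in `[0, 1]].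

Definition relint A : set 'rV[R]_N :=
  [set x | A x /\ \forall y \near x, affine_span A y -> A y].

Definition is_face K F : Prop :=
  [/\ F `<=` K, @convex_set R 'rV[R]_N F &
      forall x y, segment x y `<=` K ->
        relint (segment x y) `&` F !=set0 -> segment x y `<=` F].

Definition minimal_face K A : set 'rV[R]_N :=
  \bigcap_(F in [set F | is_face K F /\ A `<=` F]) F.

Lemma is_face_minimal_face K A :
  @convex_set R 'rV[R]_N K -> A `<=` K -> is_face K (minimal_face K A).
Proof.
move=> cK AK; have fK : is_face K K by split.
split=> [x|x y l|x y xyK [p [pxy pF]] z zxy F].
- by apply; split.
- rewrite !inE => xF yF F fF; have [_ cF _] := fF.1.
  by apply/set_mem/cF; apply/mem_set; [exact: xF|exact: yF].
- move=> [fF AF]; have [_ _ sF] := fF.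
  by apply: (sF x y) => //; exists p; split => //; exact: pF.
Qed.

(* g is C^1 on the set K, which may have empty interior, when it is the
   restriction to K of a C^1 map defined on an open neighbourhood of K. *)
Definition C1_on K (g : 'rV[R]_N -> 'rV[R]_N) : Prop :=
  exists (U : set 'rV[R]_N) (h : 'rV[R]_N -> 'rV[R]_N),
    [/\ open U, K `<=` U, {in K, h =1 g},
        (forall x, U x -> differentiable h x) &
        (forall x, U x -> {for x, continuous (jacobian h)})].

(* Absolute continuity on the compact interval [a, b]. *)
Definition abs_continuous (a b : R) (z : R -> 'rV[R]_N) : Prop :=
  forall e : R, 0 < e -> exists2 d : R, 0 < d &
    forall (k : nat) (u v : 'I_k -> R),
      (forall i, [/\ a <= u i, u i <= v i & v i <= b]) ->
      trivIset setT (fun i => `]u i, v i[%classic) ->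
      \sum_(i < k) (v i - u i) < d ->
      \sum_(i < k) eucl_dist (z (v i)) (z (u i)) < e.

(* A solution in K, on [0, +oo[, of z' = g(z).  The derivative is two-sided;
   this is harmless as {0} is a null set. *)
Definition caratheodory_solution K (g : 'rV[R]_N -> 'rV[R]_N)
    (z : R -> 'rV[R]_N) : Prop :=
  [/\ (forall t : R, 0 <= t -> K (z t)),
      (forall T : R, 0 <= T -> abs_continuous 0 T z) &
      {ae lebesgue_measure, forall t : R, 0 <= t -> is_derive t 1 z (g (z t))}].

(* Semi-flows and flows on (X, eucl_dist) are total functions of which only the
   values at times t >= 0 (resp. t in R) and points of X are meaningful. *)
Record semi_flow (phi : R -> 'rV[R]_N -> 'rV[R]_N) X : Prop := SemiFlow {
  semi_flow_fun : forall (t : R) x, 0 <= t -> X x -> X (phi t x);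
  semi_flow_continuous :
    {within [set p : R * 'rV[R]_N | 0 <= p.1 /\ X p.2],
      continuous (fun p : R * 'rV[R]_N => phi p.1 p.2)};
  semi_flow0 : forall x, X x -> phi 0 x = x;
  semi_flowD : forall (t s : R) x, 0 <= t -> 0 <= s -> X x ->
    phi (t + s) x = phi t (phi s x) }.

Record flow (phi : R -> 'rV[R]_N -> 'rV[R]_N) X : Prop := Flow {
  flow_fun : forall t x, X x -> X (phi t x);
  flow_continuous :
    {within [set p : R * 'rV[R]_N | X p.2],
      continuous (fun p : R * 'rV[R]_N => phi p.1 p.2)};
  flow0 : forall x, X x -> phi 0 x = x;
  flowD : forall t s x, X x -> phi (t + s) x = phi t (phi s x) }.

Definition isometry_on X (f : 'rV[R]_N -> 'rV[R]_N) : Prop :=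
  set_bij X X f /\ forall x y, X x -> X y -> eucl_dist (f x) (f y) = eucl_dist x y.

Definition flow_of_isometries (phi : R -> 'rV[R]_N -> 'rV[R]_N) X : Prop :=
  flow phi X /\ forall t, isometry_on X (phi t).

Definition equilibria (phi : R -> 'rV[R]_N -> 'rV[R]_N) X : set 'rV[R]_N :=
  [set x | X x /\ forall t : R, 0 <= t -> phi t x = x].

(* X `&` closure _ is the closure in the metric space X. *)
Definition omega_limit (phi : R -> 'rV[R]_N -> 'rV[R]_N) X : set 'rV[R]_N :=
  \bigcup_(x in X) \bigcap_(t in [set t : R | 0 <= t])
    (X `&` closure [set phi s x | s in [set s : R | t <= s]]).

(* phi(-t) := phi(t)^-1 on X for t > 0. *)
Definition extend_flow (phi : R -> 'rV[R]_N -> 'rV[R]_N) X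
    : R -> 'rV[R]_N -> 'rV[R]_N :=
  fun t => if 0 <= t then phi t else pinv X (phi (- t)).

Definition defines_flow (phi : R -> 'rV[R]_N -> 'rV[R]_N) X : Prop :=
  (forall t : R, 0 <= t -> set_bij X X (phi t)) /\ flow (extend_flow phi X) X.

Definition projected_field K (f : 'rV[R]_N -> 'rV[R]_N) : 'rV[R]_N -> 'rV[R]_N :=
  fun z => f z - proj (normal_cone K z) (f z).

Definition affine_projected_field V (f : 'rV[R]_N -> 'rV[R]_N)
    : 'rV[R]_N -> 'rV[R]_N :=
  fun z => f z - proj (normal_cone_aff V) (f z).

End Euclidean.

(* Main.v *)
(** Since f is dissipative and normal vectors point outward, the semi-flow is
    nonexpansive.  A point of an omega-limit set then returns arbitrarily close
    to itself, any two such points do so simultaneously, and hence phi(t) is an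
    isometry of Omega onto itself.

    Distances to two points determine a point of the segment between them, so
    Omega is convex and phi(t) is affine on it.  The points of Omega lying at
    relative depth r in Omega form a closed convex invariant set; the one
    nearest to an equilibrium is itself an equilibrium c.  Being relatively
    interior to Omega, c satisfies: the minimal face F that contains the
    equilibria is the set of v in K such that the segment [v, c] can be
    prolonged beyond c in K, and F contains Omega.

    Along an orbit z in Omega, |z - c| is constant, which forces the normal
    component n = P_{N_K(z)}(f(z)) to be orthogonal to z - c; as c is relatively
    interior to F, n is orthogonal to V.  The velocity f(z) - n is tangent to V,
    so n = P_{N_V}(f(z)) for almost all t, and then for all t because the right
    hand side is continuous. *)

From Pilot Require Import Defs.
From HB Require Import structures.
From mathcomp Require Import all_boot all_order all_algebra.
From mathcomp Require Import all_classical all_reals all_analysis.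
From mathcomp Require Import measurable_realfun.
From mathcomp Require Import ring lra.
Set Implicit Arguments.
Unset Strict Implicit.
Unset Printing Implicit Defensive.
Import Order.TTheory GRing.Theory Num.Theory.
Import numFieldNormedType.Exports.
Local Open Scope classical_set_scope.
Local Open Scope ring_scope.

(* mathcomp-analysis has a [proj] of its own, which shadows that of Defs. *)
Local Notation proj := Pilot.Defs.proj.

(** * Euclidean geometry and projections *)

Section EuclideanGeometry.
Context {R : realType} {N : nat}.
Implicit Types (x y z w p q : 'rV[R]_N) (C K : set 'rV[R]_N).

Lemma dotE x y : dot x y = \sum_i x 0 i * y 0 i.
Proof. by rewrite /dot mxE; apply: eq_bigr => i _; rewrite mxE. Qed.

Lemma dotC x y : dot x y = dot y x.
Proof. by rewrite !dotE; apply: eq_bigr => i _; rewrite mulrC. Qed.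

Lemma dotDl x y z : dot (x + y) z = dot x z + dot y z.
Proof. by rewrite /dot mulmxDl mxE. Qed.

Lemma dotZl (a : R) x z : dot (a *: x) z = a * dot x z.
Proof. by rewrite /dot -scalemxAl mxE. Qed.

Lemma dotNl x z : dot (- x) z = - dot x z.
Proof. by rewrite -scaleN1r dotZl mulN1r. Qed.

Lemma dotDr x y z : dot z (x + y) = dot z x + dot z y.
Proof. by rewrite dotC dotDl !(dotC z). Qed.

Lemma dotZr (a : R) x z : dot z (a *: x) = a * dot z x.
Proof. by rewrite dotC dotZl dotC. Qed.

Lemma dotNr x z : dot z (- x) = - dot z x.
Proof. by rewrite dotC dotNl dotC. Qed.

Definition dot_lin := (dotDl, dotDr, dotNl, dotNr, dotZl, dotZr).

Lemma dot_subZ (t : R) x y :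
  dot (x - t *: y) (x - t *: y) = dot x x - 2 * t * dot x y + t ^+ 2 * dot y y.
Proof. by rewrite !dot_lin (dotC y x); ring. Qed.

Lemma dot0l x : dot 0 x = 0.
Proof. by rewrite -(scale0r x) dotZl mul0r. Qed.

Lemma dot0r x : dot x 0 = 0.
Proof. by rewrite dotC dot0l. Qed.

Lemma dot_ge0 x : 0 <= dot x x.
Proof. by rewrite dotE sumr_ge0// => i _; rewrite -expr2 sqr_ge0. Qed.

Lemma dot_eq0 x : dot x x = 0 -> x = 0.
Proof.
rewrite dotE => /eqP; rewrite psumr_eq0; last first.
  by move=> i _; rewrite -expr2 sqr_ge0.
move=> /allP x0; apply/rowP => i; rewrite mxE.
have := x0 i; rewrite mem_index_enum -expr2 sqrf_eq0 => /(_ isT)/=.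
by move=> /eqP.
Qed.

Lemma eucl_norm_ge0 x : 0 <= eucl_norm x.
Proof. exact: sqrtr_ge0. Qed.

Lemma sqr_eucl_norm x : eucl_norm x ^+ 2 = dot x x.
Proof. by rewrite /eucl_norm sqr_sqrtr// dot_ge0. Qed.

Lemma eucl_norm_le x y : dot x x <= dot y y -> eucl_norm x <= eucl_norm y.
Proof. by move=> xy; rewrite /eucl_norm ler_wsqrtr. Qed.

Lemma eucl_norm_leP x y : (eucl_norm x <= eucl_norm y) = (dot x x <= dot y y).
Proof. by rewrite -!sqr_eucl_norm ler_sqr// nnegrE eucl_norm_ge0. Qed.

Lemma eucl_norm0 : eucl_norm (0 : 'rV[R]_N) = 0.
Proof. by rewrite /eucl_norm dot0l sqrtr0. Qed.

Lemma eucl_norm_eq0 x : eucl_norm x = 0 -> x = 0.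
Proof. by move=> x0; apply: dot_eq0; rewrite -sqr_eucl_norm x0 expr0n. Qed.

Lemma eucl_normZ (a : R) x : eucl_norm (a *: x) = `|a| * eucl_norm x.
Proof.
rewrite /eucl_norm dotZl dotZr mulrA -expr2 sqrtrM ?sqr_ge0//.
by rewrite sqrtr_sqr.
Qed.

Lemma eucl_normN x : eucl_norm (- x) = eucl_norm x.
Proof. by rewrite -scaleN1r eucl_normZ normrN normr1 mul1r. Qed.

Lemma cauchy_schwarz x y : dot x y <= eucl_norm x * eucl_norm y.
Proof.
have [->|/eqP x0] := eqVneq x 0; first by rewrite dot0l eucl_norm0 mul0r.
set a := eucl_norm x; set b := eucl_norm y.
have a0 : 0 < a.
  rewrite lt_neqAle eucl_norm_ge0 andbT; apply/eqP => a0.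
  by apply: x0; exact: eucl_norm_eq0.
have := dot_ge0 (a *: y - b *: x); rewrite !dot_lin (dotC y x).
rewrite -!sqr_eucl_norm -/a -/b => h.
have b0 : 0 <= b by exact: eucl_norm_ge0.
have [b00|b1] := eqVneq b 0.
  by rewrite (eucl_norm_eq0 b00) dot0r b00 mulr0.
have ab : 0 < a * b by rewrite mulr_gt0// lt_neqAle eq_sym b1.
rewrite -(ler_pM2l ab); nra.
Qed.

Lemma eucl_normD x y : eucl_norm (x + y) <= eucl_norm x + eucl_norm y.
Proof.
rewrite -ler_sqr ?nnegrE ?addr_ge0 ?eucl_norm_ge0// sqr_eucl_norm !dot_lin.
have := cauchy_schwarz x y; rewrite (dotC y x) -!sqr_eucl_norm.
by move=> h; rewrite sqrrD; lra.
Qed.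

Lemma eucl_distC x y : eucl_dist x y = eucl_dist y x.
Proof. by rewrite /eucl_dist -opprB eucl_normN. Qed.

Lemma eucl_dist_ge0 x y : 0 <= eucl_dist x y.
Proof. exact: eucl_norm_ge0. Qed.

Lemma eucl_distxx x : eucl_dist x x = 0.
Proof. by rewrite /eucl_dist subrr eucl_norm0. Qed.

Lemma eucl_dist_triangle y x z : eucl_dist x z <= eucl_dist x y + eucl_dist y z.
Proof. by rewrite /eucl_dist -(subrKA y x); exact: eucl_normD. Qed.

Lemma eucl_dist_eq0 x y : eucl_dist x y <= 0 -> x = y.
Proof.
move=> h; apply/eqP; rewrite -subr_eq0; apply/eqP/eucl_norm_eq0.
by apply/eqP; rewrite eq_le h eucl_dist_ge0.
Qed.

Lemma eucl_dist_small_eq x y :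
  (forall e : R, 0 < e -> eucl_dist x y < e) -> x = y.
Proof.
move=> h; apply: eucl_dist_eq0; rewrite leNgt; apply/negP => /h.
by rewrite ltxx.
Qed.

Lemma le_norm_eucl x : `|x| <= eucl_norm x.
Proof.
rewrite [leLHS]/Num.Def.normr/= mx_normrE (bigmax_le _ (eucl_norm_ge0 _))//=.
move=> [i j] _ /=; rewrite ord1 -ler_sqr ?nnegrE ?eucl_norm_ge0//.
rewrite sqr_eucl_norm real_normK ?num_real// dotE (bigD1 j)//= -expr2 lerDl.
by rewrite sumr_ge0// => k _; rewrite -expr2 sqr_ge0.
Qed.

Lemma coord_le_norm x i : `|x 0 i| <= `|x|.
Proof.
rewrite [leRHS]/Num.Def.normr/= mx_normrE.
exact: (le_bigmax _ (fun ij : 'I_1 * 'I_N => `|x ij.1 ij.2|) (0, i)).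
Qed.

(** The factor N + 1 is crude, but it stays positive for N = 0, so that [nbhs_euclP] can divide by
    it. *)
Lemma eucl_le_norm x : eucl_norm x <= N.+1%:R * `|x|.
Proof.
rewrite -ler_sqr ?nnegrE ?eucl_norm_ge0 ?mulr_ge0//.
rewrite sqr_eucl_norm dotE (@le_trans _ _ (\sum_(i < N) `|x| ^+ 2))//.
  apply: ler_sum => i _; rewrite -expr2 -real_normK ?num_real//.
  by rewrite ler_sqr ?nnegrE// coord_le_norm.
rewrite sumr_const card_ord -[leLHS]mulr_natl exprMn ler_wpM2r ?sqr_ge0//.
rewrite -natrX ler_nat expnS expn1.
by apply: (@leq_trans N.+1); rewrite ?leqnSn// leq_pmulr.
Qed.

(** * Topology and convexity in terms of the Euclidean distance *)

Lemma nbhs_euclP x (U : set 'rV[R]_N) :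
  nbhs x U <-> exists2 e : R, 0 < e & forall y, eucl_dist x y < e -> U y.
Proof.
split=> [/nbhs_ballP[e /= e0 eU]|[e e0 eU]].
  exists e => // y xy; apply: eU; rewrite -ball_normE /ball_/=.
  exact: le_lt_trans (le_norm_eucl _) xy.
apply/nbhs_ballP; exists (e / N.+1%:R); first by rewrite /= divr_gt0.
move=> y; rewrite -ball_normE /ball_/= => xy; apply: eU.
by apply: le_lt_trans (eucl_le_norm _) _; rewrite -ltr_pdivlMl// mulrC.
Qed.

Lemma cvg_euclP T (F : set_system T) (FF : Filter F) (g : T -> 'rV[R]_N) x :
  g @ F --> x <->
  forall e : R, 0 < e -> \forall t \near F, eucl_dist x (g t) < e.
Proof.
split=> [gx e e0|h A /nbhs_euclP[e e0 eA]].
  have /gx : nbhs x [set y | eucl_dist x y < e] by apply/nbhs_euclP; exists e.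
  by [].
by apply: filterS (h _ e0) => t /eA.
Qed.

Lemma closure_euclP (A : set 'rV[R]_N) x :
  closure A x <-> forall e : R, 0 < e -> exists2 y, A y & eucl_dist x y < e.
Proof.
split=> [cA e e0|h B /nbhs_euclP[e e0 eB]].
  have /cA[y [Ay xy]] : nbhs x [set y | eucl_dist x y < e].
    by apply/nbhs_euclP; exists e.
  by exists y.
by have [y Ay xy] := h _ e0; exists y; split => //; exact: eB.
Qed.

(** Trades the bundled weights of [convex_set] for plain real numbers; the two points are swapped
    because there the weight falls on the first one. *)
Lemma convexP K : @convex_set R 'rV[R]_N K <->
  forall x y (t : R), 0 <= t -> t <= 1 -> K x -> K y ->
    K ((1 - t) *: x + t *: y).
Proof.
split=> [cK x y t t0 t1 Kx Ky|cK].
  have t01 : Itv.spec (@Itv.num_sem R) (Itv.Real `[0%Z, 1%Z]) t.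
    by apply/andP; split; [exact: num_real|rewrite in_itv/= t0 t1].
  have := cK y x (Itv.mk t01) (mem_set Ky) (mem_set Kx).
  by rewrite inE addrC.
apply/convex_setW => x y; rewrite !inE => Kx Ky l l0 l1.
rewrite inE.
have := cK y x l%:num (ltW l0) (ltW l1) Ky Kx.
by rewrite addrC.
Qed.

Lemma bounded_eucl_compact C x (r : R) :
  closed C -> (forall y, C y -> eucl_dist x y <= r) -> compact C.
Proof.
move=> cC Cr; apply: bounded_closed_compact => //.
exists (eucl_norm x + r); split; first exact: num_real.
move=> M hM y Cy; apply: le_trans (le_norm_eucl _) _.
apply: le_trans (ltW hM); have := eucl_normD x (- (x - y)).
rewrite opprB subrKC => /le_trans; apply.
by rewrite lerD2l -/(eucl_dist y x) eucl_distC; exact: Cr.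
Qed.

Lemma eucl_dist_continuous x : continuous (eucl_dist x).
Proof.
move=> y; apply/(@cvgrPdist_lt _ _ _ (nbhs y) (nbhs_filter y)) => e e0.
apply/nbhs_euclP; exists e => // z yz.
rewrite ltr_norml; have := eucl_dist_triangle y x z.
have := eucl_dist_triangle z x y; rewrite (eucl_distC z y).
by move=> h1 h2; apply/andP; split; lra.
Qed.

(** Only the points of C no farther from x than some q0 in C matter; they form a compact set, on
    which the distance attains its minimum. *)
Lemma proj_spec C x : closed C -> C !=set0 ->
  C (proj C x) /\ forall q, C q -> eucl_dist x (proj C x) <= eucl_dist x q.
Proof.
move=> cC [q0 Cq0].
pose D := C `&` [set q | eucl_dist x q <= eucl_dist x q0].
have cD : closed D.
  apply: closedI => //.
  have := @closed_comp _ _ (eucl_dist x) [set r | r <= eucl_dist x q0].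
  apply; last exact: closed_le.
  by move=> y _; exact: eucl_dist_continuous.
have [] := @EVT_min_rV R N (eucl_dist x) D.
- by exists q0; split => /=.
- by apply: (@bounded_eucl_compact D x (eucl_dist x q0)) => // y [].
- by apply: continuous_subspaceT => y; exact: eucl_dist_continuous.
move=> c cDc hc; have [Cc /= xc] := set_mem cDc.
suff : [set p | C p /\ forall q, C q -> eucl_dist x p <= eucl_dist x q]
    (proj C x).
  by [].
apply: getPex; exists c; split => // q Cq.
have [xq|/ltW xq] := leP (eucl_dist x q) (eucl_dist x q0).
  by apply: hc; rewrite inE.
exact: le_trans xq.
Qed.

Lemma proj_dot_le C x q : closed C -> @convex_set R 'rV[R]_N C -> C !=set0 ->
  C q -> dot (x - proj C x) (q - proj C x) <= 0.
Proof.
move=> cC /convexP vC C0 Cq; have [Cp hp] := proj_spec x cC C0.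
set p := proj C x in Cp hp *.
rewrite leNgt; apply/negP => h.
set a := dot (x - p) (q - p) in h; set b := dot (q - p) (q - p).
have b0 : 0 <= b by exact: dot_ge0.
(* Moving the fraction t of the way from p to q changes the squared distance to x by t(tb - 2a),
   which is negative once t(b + 1) <= a. *)
pose t := Num.min 1 (a / (b + 1)).
have b1 : 0 < b + 1 by lra.
have t0 : 0 < t by rewrite lt_min ltr01 divr_gt0.
have t1 : t <= 1 by rewrite ge_min lexx.
have tab : t * (b + 1) <= a by rewrite -ler_pdivlMr// ge_min lexx orbT.
have /hp := vC p q t (ltW t0) t1 Cp Cq.
have -> : eucl_dist x p = eucl_norm (x - p) by [].
rewrite eucl_norm_leP.
have -> : x - ((1 - t) *: p + t *: q) = (x - p) - t *: (q - p).
  by apply/rowP => i; rewrite !mxE; ring.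
rewrite dot_subZ -/a -/b; nra.
Qed.

(** The obtuse angle condition gives |x - q|^2 >= |x - p|^2 + |q - p|^2 for q in C, so p is a
    nearest point and the only one. *)
Lemma proj_unique C x p : C p ->
  (forall q, C q -> dot (x - p) (q - p) <= 0) -> proj C x = p.
Proof.
move=> Cp hp.
have near q : C q ->
    dot (x - p) (x - p) + dot (q - p) (q - p) <= dot (x - q) (x - q).
  move=> Cq; have := hp q Cq.
  have -> : x - q = (x - p) - (q - p) by rewrite opprB addrA subrK.
  by rewrite !dot_lin (dotC x q) (dotC p q) (dotC x p); lra.
have [] : [set p | C p /\ forall q, C q -> eucl_dist x p <= eucl_dist x q]
    (proj C x).
  apply: getPex; exists p; split => // q Cq.
  by apply: eucl_norm_le; have := near q Cq; have := dot_ge0 (q - p); lra.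
move=> Cp' /(_ p Cp); rewrite eucl_norm_leP => h.
apply/eqP; rewrite -subr_eq0; apply/eqP/dot_eq0.
by have := near _ Cp'; have := dot_ge0 (proj C x - p); lra.
Qed.

Lemma closed_euclP (A : set 'rV[R]_N) :
  (forall x,
    (forall e : R, 0 < e -> exists2 y, A y & eucl_dist x y < e) -> A x) ->
  closed A.
Proof. by move=> h x /closure_euclP; exact: h. Qed.

Lemma proj_nearest (C : set 'rV[R]_N) x p : closed C ->
  @convex_set R 'rV[R]_N C -> C p ->
  eucl_dist x p <= eucl_dist x (proj C x) -> p = proj C x.
Proof.
move=> cC vC Cp; have C0 : C !=set0 by exists p.
have := proj_dot_le x cC vC C0 Cp; rewrite eucl_norm_leP.
set r := proj C x => h.
have -> : x - p = (x - r) - 1 *: (p - r).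
  by rewrite scale1r opprB addrA subrK.
rewrite dot_subZ => h2.
apply/eqP; rewrite -subr_eq0; apply/eqP/dot_eq0.
have := dot_ge0 (p - r); move: h h2; rewrite expr1n mul1r mulr1.
by move=> ? ? ?; lra.
Qed.

(* The three distances pin down an affine combination:
   |q - ((1-l)a + lb)|^2 = (1-l)|q-a|^2 + l|q-b|^2 - l(1-l)|a-b|^2. *)
Lemma affine_combination_rigid (l : R) (a b a' b' q' : 'rV[R]_N) :
  0 <= l -> l <= 1 ->
  eucl_dist a' b' = eucl_dist a b ->
  eucl_dist q' a' <= eucl_dist ((1 - l) *: a + l *: b) a ->
  eucl_dist q' b' <= eucl_dist ((1 - l) *: a + l *: b) b ->
  q' = (1 - l) *: a' + l *: b'.
Proof.
move=> l0 l1 ab; rewrite !eucl_norm_leP.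
have {}ab : dot (a' - b') (a' - b') = dot (a - b) (a - b).
  by rewrite -!sqr_eucl_norm -!/(eucl_dist _ _) ab.
have key (u v w : 'rV[R]_N) :
    dot (u - ((1 - l) *: v + l *: w)) (u - ((1 - l) *: v + l *: w)) =
    (1 - l) * dot (u - v) (u - v) + l * dot (u - w) (u - w)
    - l * (1 - l) * dot (v - w) (v - w).
  by rewrite !dot_lin (dotC v u) (dotC w u) (dotC w v); ring.
set q := (1 - l) *: a + l *: b => h1 h2.
have := key q' a' b'; have := key q a b; rewrite -/q subrr dot0l ab => e1 e2.
have l1' : 0 <= 1 - l by lra.
have := ler_wpM2l l0 h2; have := ler_wpM2l l1' h1 => h3 h4.
apply/eqP; rewrite -subr_eq0; apply/eqP/dot_eq0.
have := dot_ge0 (q' - ((1 - l) *: a' + l *: b')); lra.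
Qed.

(** The missing weight falls on o. The induction splits off the last point and rescales the other
    weights by 1 / (1 - s); if s >= 1, they all vanish. *)
Lemma convex_combination (S : set 'rV[R]_N) (o : 'rV[R]_N) :
  @convex_set R 'rV[R]_N S -> S o ->
  forall (k : nat) (a : 'I_k -> 'rV[R]_N) (w : 'I_k -> R),
  (forall i, S (o + a i)) -> (forall i, 0 <= w i) -> \sum_i w i <= 1 ->
  S (o + \sum_i w i *: a i).
Proof.
move=> /convexP vS So; elim=> [|k IH] a w Sa w0.
  by rewrite !big_ord0 addr0.
rewrite !big_ord_recr/=; set s := w ord_max; set W := \sum_(i < k) _ => Ws.
have W0 : 0 <= W by apply: sumr_ge0.
have s0 : 0 <= s by exact: w0.
have [s1|s1] := leP 1 s.
  have W00 : W = 0 by lra.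
  have -> : s = 1 by lra.
  rewrite big1 ?add0r ?scale1r// => i _.
  have /eqP := W00; rewrite psumr_eq0// => /allP/(_ i).
  by rewrite mem_index_enum => /(_ isT)/eqP ->; rewrite scale0r.
have s1' : 0 < 1 - s by rewrite subr_gt0.
have s1n : 1 - s != 0 by rewrite lt0r_neq0.
pose wi (i : 'I_k) := widen_ord (leqnSn k) i.
have -> : o + (\sum_(i < k) w (wi i) *: a (wi i) + s *: a ord_max) =
    (1 - s) *: (o + \sum_(i < k) (w (wi i) / (1 - s)) *: a (wi i)) +
    s *: (o + a ord_max).
  rewrite !scalerDr scaler_sumr.
  under [in RHS]eq_bigr => i _ do rewrite scalerA mulrCA divff// mulr1.
  by rewrite scalerBl scale1r; apply/rowP => i; rewrite !mxE; ring.
apply: vS => //; first exact: ltW.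
apply: IH => // [i|]; first by rewrite divr_ge0 ?w0// ltW.
by rewrite -mulr_suml ler_pdivrMr// mul1r; rewrite -/W; lra.
Qed.

End EuclideanGeometry.

(** * Absolutely continuous functions and their derivatives *)

Section AlmostEverywhereDerivative.
Context {R : realType}.
Local Notation mu := (@lebesgue_measure R).

(** Clearing the denominator of the difference quotient gives an estimate that also covers y = s. *)
Lemma is_derive_approx (V : normedModType R) (F : R -> V) (s : R) (l : V) :
  is_derive s 1 F l <->
  forall e : R, 0 < e -> exists2 d : R, 0 < d & forall y, `|y - s| < d ->
    `|F y - F s - (y - s) *: l| <= e * `|y - s|.
Proof.
have key (l' : V) (e h : R) : h != 0 ->
    (`|l' - h^-1 *: (F (h *: 1 + s) - F s)| <= e) =
    (`|F (h + s) - F s - h *: l'| <= e * `|h|).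
  move=> h0; rewrite [h *: 1]mulr1.
  have -> : F (h + s) - F s - h *: l' = - (h *: (l' - h^-1 *: (F (h + s) - F s))).
    by rewrite scalerBr scalerA divff// scale1r opprB.
  by rewrite normrN normrZ mulrC ler_pM2r// normr_gt0.
split=> [[dF <-{l}] e e0|h].
  have : h^-1 *: (F (h *: 1 + s) - F s) @[h --> 0^'] --> 'D_1 F s by exact: dF.
  move=> /cvgrPdist_le/(_ e e0)[d /= d0 de]; exists d => // y yd.
  have [->|ys] := eqVneq y s.
    by rewrite !subrr scale0r subr0 !normr0 mulr0.
  have h0 : y - s != 0 by rewrite subr_eq0.
  have := de (y - s); rewrite /ball_/= sub0r normrN => /(_ yd h0).
  by rewrite key// subrK.
have cl : h^-1 *: (F (h *: 1 + s) - F s) @[h --> 0^'] --> l.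
  apply/cvgrPdist_le => e e0; have [d d0 de] := h e e0.
  exists d => //= x; rewrite /ball_/= sub0r normrN => xd x0.
  by rewrite key//; have := de (x + s); rewrite addrK; exact.
by apply: DeriveDef; [apply/cvg_ex; exists l|exact/cvg_lim].
Qed.

Definition abs_continuous_fun (a b : R) (F : R -> R) : Prop :=
  forall e : R, 0 < e -> exists2 d : R, 0 < d &
    forall (k : nat) (u v : 'I_k -> R),
      (forall i, [/\ a <= u i, u i <= v i & v i <= b]) ->
      trivIset setT (fun i => `]u i, v i[%classic) ->
      \sum_(i < k) (v i - u i) < d ->
      \sum_(i < k) `|F (v i) - F (u i)| < e.

Lemma sum_itv_le_measure (k : nat) (u v : 'I_k -> R) (U : set R) :
  measurable U -> (forall i, u i <= v i) ->
  trivIset setT (fun i => `]u i, v i[%classic) ->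
  (forall i, `]u i, v i[%classic `<=` U) ->
  ((\sum_(i < k) (v i - u i))%:E <= mu U)%E.
Proof.
move=> mO uv tuv uvO.
have -> : ((\sum_(i < k) (v i - u i))%:E =
    mu (\big[setU/set0]_(i < k) `]u i, v i[%classic))%E.
  rewrite measure_bigsetU_ord//=.
  rewrite -sumEFin; apply: eq_bigr => i _; rewrite lebesgue_measure_itv/= lte_fin.
  have := uv i; rewrite le_eqVlt => /orP[/eqP ->|->//].
  by rewrite ltxx subrr.
apply: le_measure; rewrite ?inE//.
- by apply: bigsetU_measurable => i _; exact: measurable_itv.
- elim/big_ind : _ => [//|A B AO BO z [/AO|/BO]//|i _].
  exact: uvO.
Qed.

(* Cover the exceptional null set by an open U of measure less than d.  The
   points y reachable from a with F y - F a <= e (y - a) + (the variation of F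
   over finitely many disjoint intervals contained in U) exhaust [a, b], and
   absolute continuity bounds that variation by e. *)
Lemma ae_derive_le0_nonincreasing (F : R -> R) (a b : R) : a <= b ->
  abs_continuous_fun a b F ->
  {ae mu, forall t, a <= t -> t <= b ->
    exists2 l : R, l <= 0 & is_derive t 1 F l} ->
  F b <= F a.
Proof.
move=> ab acF [A [mA A0 NA]].
have muA0 : mu (A : set R) = 0%E by [].
have dF t : a <= t -> t <= b -> ~ A t -> exists2 l : R, l <= 0 & is_derive t 1 F l.
  by move=> at_ tb nAt; apply: contrapT => h; apply: nAt; apply: NA => /(_ at_ tb).
apply/ler_addgt0Pr => e' e'0; rewrite -lerBlDl.
(* The error e' is split into a slope e over [a, b] and a variation e over the intervals in U. *)
pose e := e' / (b - a + 1).
have ba1 : 0 < b - a + 1 by lra.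
have e0 : 0 < e by rewrite divr_gt0.
have -> : e' = e * (b - a) + e.
  by rewrite -[X in _ + X]mulr1 -mulrDr mulfVK// lt0r_neq0.
have [d d0 acd] := acF e e0.
have [U [oO AO muO]] : exists U : set R, [/\ open U, A `<=` U & (mu U < d%:E)%E].
  have [ |U [oO AO muO]] := @lebesgue_regularity_outer R A d mA _ d0.
    exact: (eq_ind_r (fun x => x < +oo)%E (ltry 0) muA0).
  have mO : measurable U by exact: open_measurable.
  exists U; split => //; apply: le_lt_trans muO.
  have -> : (mu U = mu (U `\` A) + mu (U `&` A))%E by exact: measureDI.
  by rewrite setIidr// muA0 adde0.
(* The intervals are listed from left to right and indexed by naturals, so that one more can be
   appended at the right end. *)
pose good y := exists (k : nat) (u v : nat -> R),
  [/\ forall i, (i < k)%N -> [/\ a <= u i, u i <= v i & v i <= y],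
      forall i j, (i < j)%N -> (j < k)%N -> v i <= u j,
      forall i, (i < k)%N -> `]u i, v i[%classic `<=` U &
      F y - F a <= e * (y - a) + \sum_(i < k) `|F (v i) - F (u i)|].
(* Each s has a neighbourhood across which goodness passes from left to right. If s is in A, append
   the interval ]y, y'[, which lies in U; otherwise the derivative at s bounds F y' - F s and F s -
   F y. *)
have step s : a <= s -> s <= b -> exists2 r : R, 0 < r & forall y y',
    s - r < y -> y <= s -> s <= y' -> y' < s + r -> a <= y -> good y -> good y'.
  move=> as_ sb; have [As|nAs] := pselect (A s).
    have /nbhs_ballP[r /= r0 rO] : nbhs s U.
      by apply: open_nbhs_nbhs; split => //; exact: AO.
    exists r => // y y' sy ys sy' y'r ay [k [u [v [uv dis inO le]]]].
    exists k.+1, (fun i => if i == k then y else u i).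
    exists (fun i => if i == k then y' else v i).
    split.
    - move=> i; rewrite ltnS; case: eqVneq => [_ _|ik].
        by split; lra.
      rewrite leq_eqVlt (negbTE ik)/= => /uv[? ? ?]; split => //.
      by lra.
    - move=> i j ij; rewrite ltnS => jk.
      have ik := leq_trans ij jk.
      rewrite (ltn_eqF ik); case: eqVneq => [_|jk'].
        by have [] := uv _ ik.
      by apply: dis => //; rewrite ltn_neqAle jk'.
    - move=> i; rewrite ltnS; case: eqVneq => [_ _|ik].
        move=> z /=; rewrite in_itv/= => /andP[yz zy']; apply: rO.
        by rewrite /ball/= ltr_norml; apply/andP; split; lra.
      by rewrite leq_eqVlt (negbTE ik)/= => /inO.
    rewrite big_ord_recr/= eqxx.
    under eq_bigr => i _ do rewrite (ltn_eqF (ltn_ord i)).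
    have := ler_norm (F y' - F y); have : 0 <= e * (y' - y).
      by rewrite mulr_ge0 ?subr_ge0 ?(ltW e0)// (le_trans ys).
    by rewrite mulrBr => h1 h2; rewrite mulrBr in le *; lra.
  have [l l0 /is_derive_approx/(_ e e0)[r r0 rF]] := dF s as_ sb nAs.
  exists r => // y y' sy ys sy' y'r ay [k [u [v [uv dis inO le]]]].
  exists k, u, v; split => //.
    by move=> i /uv[? ? ?]; split => //; lra.
  have h1 : F y' - F s <= e * (y' - s).
    have := rF y'; rewrite ger0_norm ?subr_ge0// => /(_ ltac:(lra)).
    rewrite ler_norml => /andP[_]; rewrite [_ *: l]/GRing.scale/=.
    have : (y' - s) * l <= 0 by rewrite mulr_ge0_le0// subr_ge0.
    by lra.
  have h2 : F s - F y <= e * (s - y).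
    have := rF y; rewrite ler0_norm ?subr_le0// => /(_ ltac:(lra)).
    rewrite ler_norml => /andP[+ _]; rewrite [_ *: l]/GRing.scale/=.
    have : 0 <= (y - s) * l by rewrite mulr_le0// subr_le0.
    by rewrite opprB; lra.
  by rewrite !mulrBr in le h1 h2 *; lra.
have good_a : good a.
  exists 0%N, (fun=> 0), (fun=> 0); split => //.
  by rewrite !subrr mulr0 big_ord0 addr0.
(* By [step], goodness passes across the supremum of the good points, which therefore cannot lie
   below b. *)
pose S := [set y | [/\ a <= y, y <= b & good y]].
have Sa : S a by split.
have supS : has_sup S by split; [exists a|exists b => y []].
pose s := sup S.
have ubS y : S y -> y <= s by exact: sup_upper_bound.
have as_ : a <= s by exact: ubS.
have sb : s <= b by apply: ge_sup; [exists a|move=> y []].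
have [r r0 sr] := step s as_ sb.
have [y [ay yb gy] sy] := sup_adherent r0 supS.
have ys : y <= s by exact: ubS.
have good_b : good b.
  have [bs|sb'] := leP b s.
    by apply: (sr y) => //; lra.
  pose y' := Num.min b (s + r / 2).
  have sy' : s < y' by rewrite lt_min sb'/= ltrDl divr_gt0.
  have y'b : y' <= b by rewrite ge_min lexx.
  have y'r : y' <= s + r / 2 by rewrite ge_min lexx orbT.
  have : S y'.
    split => //; first lra.
    by apply: (sr y) => //; lra.
  by move=> /ubS; rewrite leNgt sy'.
have [k [u [v [uv dis inO le]]]] := good_b.
apply: le_trans le _; rewrite lerD2l ltW//.
have disj : trivIset setT (fun i : 'I_k => `]u i, v i[%classic).
  apply/trivIsetP => i j _ _.
  wlog ij : i j / (i < j)%N.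
    move=> h; rewrite neq_lt => /orP[ij|ij].
      by apply: h => //; rewrite lt_eqF.
    by rewrite setIC; apply: h => //; rewrite lt_eqF.
  move=> _; apply/seteqP; split => // z [] /=; rewrite !in_itv/=.
  move=> /andP[_ zv] /andP[uz _].
  by have := dis i j ij (ltn_ord j); rewrite leNgt (lt_trans uz zv).
apply: (acd k (fun i => u i) (fun i => v i)) => //.
- by move=> i; exact: uv.
rewrite -lte_fin; apply: le_lt_trans muO.
apply: sum_itv_le_measure.
- exact: open_measurable.
- by move=> i; have [] := uv i (ltn_ord i).
- exact: disj.
- by move=> i; apply: inO; exact: ltn_ord.
Qed.

Lemma abs_continuous_funN (a b : R) (F : R -> R) :
  abs_continuous_fun a b F -> abs_continuous_fun a b (fun t => - F t).
Proof.
move=> acF e e0; have [d d0 dF] := acF e e0.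
exists d => // k u v uv tuv sd; under eq_bigr => i _ do rewrite -opprD normrN.
exact: dF.
Qed.

Lemma abs_continuous_fun_sub (a b a' b' : R) (F : R -> R) :
  a <= a' -> b' <= b ->
  abs_continuous_fun a b F -> abs_continuous_fun a' b' F.
Proof.
move=> aa bb acF e e0; have [d d0 dF] := acF e e0.
exists d => // k u v uv; apply: dF => i; have [u1 u2 u3] := uv i.
by split => //; [exact: le_trans u1|exact: le_trans u3 _].
Qed.

Lemma abs_continuous_fun_affine (a b c : R) (F : R -> R) :
  abs_continuous_fun a b F -> abs_continuous_fun a b (fun t => F t - c * t).
Proof.
move=> acF e e0; have e20 : 0 < e / 2 by rewrite divr_gt0.
have [d d0 dF] := acF _ e20.
have c0 : 0 < `|c| + 1 by rewrite ltr_wpDl.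
exists (Num.min d (e / 2 / (`|c| + 1))).
  by rewrite lt_min d0/= divr_gt0.
move=> k u v uv tuv; rewrite lt_min => /andP[sd se].
rewrite [ltRHS]splitr; apply: le_lt_trans (ltr_leD (dF _ _ _ uv tuv sd) (lexx _)).
rewrite ltr_pdivlMr// in se.
apply: (@le_trans _ _ (\sum_(i < k) (`|F (v i) - F (u i)| + `|c| * (v i - u i)))).
  apply: ler_sum => i _; have [_ uvi _] := uv i.
  have -> : F (v i) - c * v i - (F (u i) - c * u i) =
    (F (v i) - F (u i)) + - (c * (v i - u i)) by ring.
  apply: le_trans (ler_normD _ _) _.
  by rewrite normrN normrM (@ger0_norm _ (v i - u i)) ?subr_ge0.
rewrite big_split/= -mulr_sumr lerD2l; apply: le_trans (ltW se).
rewrite mulrC ler_wpM2l ?lerDl//.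
by apply: sumr_ge0 => i _; have [_ uvi _] := uv i; rewrite subr_ge0.
Qed.

Lemma ae_filter : Filter (almost_everywhere mu).
Proof. exact: (ae_filter_ringOfSetsType (@lebesgue_measure R)). Qed.

Lemma ae_imp (P Q : R -> Prop) : (forall t, P t -> Q t) ->
  {ae mu, forall t, P t} -> {ae mu, forall t, Q t}.
Proof. by move=> PQ; apply: (@filterS _ _ ae_filter). Qed.

Lemma ae_and (P Q : R -> Prop) : {ae mu, forall t, P t} ->
  {ae mu, forall t, Q t} -> {ae mu, forall t, P t /\ Q t}.
Proof. by move=> aP aQ; apply: (@filterI _ _ ae_filter). Qed.

Lemma ae_exists_itv (P : R -> Prop) (a b : R) : a < b ->
  {ae mu, forall t, P t} -> exists2 t, a < t < b & P t.
Proof.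
move=> ab [A [mA A0 NA]]; apply: contrapT => h.
have : (mu `]a, b[%classic <= mu (A : set R))%E.
  apply: le_measure; rewrite ?inE//.
  move=> t /=; rewrite in_itv/= => tab; apply: NA => Pt.
  by apply: h; exists t.
have -> : (mu (A : set R) = 0)%E by [].
by rewrite lebesgue_measure_itv/= lte_fin ab -EFinB lee_fin leNgt subr_gt0 ab.
Qed.

(** Near s the values of h are within e of h s, so F minus the line of slope h s + e is
    nonincreasing and F minus the line of slope h s - e is nondecreasing. This traps the increments
    of F. *)
Lemma ae_derive_continuous_is_derive (F h : R -> R) (a b s : R) : a < s < b ->
  abs_continuous_fun a b F ->
  {ae mu, forall t, a <= t -> is_derive t 1 F (h t)} ->
  {for s, continuous h} -> is_derive s 1 F (h s).
Proof.
move=> /andP[as_ sb] acF dF ch; apply/is_derive_approx => e e0.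
move/cvgrPdist_le : ch => /(_ e e0) /nbhs_ballP[r /= r0 rh].
pose d := Num.min r (Num.min (s - a) (b - s)).
have d0 : 0 < d by rewrite !lt_min r0 !subr_gt0 as_ sb.
have le_ (u v : R) : u <= v -> `|u - s| < d -> `|v - s| < d ->
    `|F v - F u - (v - u) * h s| <= e * (v - u).
  move=> uv; rewrite !lt_min !ltr_norml.
  move=> /and3P[/andP[ur1 ur2] /andP[ua1 ua2] /andP[ub1 ub2]].
  move=> /and3P[/andP[vr1 vr2] /andP[va1 va2] /andP[vb1 vb2]].
  have au : a <= u by lra.
  have vb : v <= b by lra.
  have acF' := abs_continuous_fun_sub au vb acF.
  have hs t : u <= t -> t <= v -> h s - e <= h t /\ h t <= h s + e.
    move=> ut tv; have := rh t; rewrite /ball/= ler_norml.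
    move=> /(_ ltac:(rewrite ltr_norml; lra)).
    by move=> /andP[h1 h2]; split; lra.
  have upper : F v - (h s + e) * v <= F u - (h s + e) * u.
    apply: (ae_derive_le0_nonincreasing (F := fun t => F t - (h s + e) * t)) => //.
      exact: abs_continuous_fun_affine.
    apply: ae_imp dF => t dFt ut tv; exists (h t - (h s + e)).
      by have [] := hs t ut tv; lra.
    have dt := dFt (le_trans au ut).
    by apply: is_derive_eq; rewrite [_ *: _]mulr1.
  have lower : - F v - (- (h s - e)) * v <= - F u - (- (h s - e)) * u.
    apply: (ae_derive_le0_nonincreasing
      (F := fun t => - F t - (- (h s - e)) * t)) => //.
      by apply: abs_continuous_fun_affine; exact: abs_continuous_funN.
    apply: ae_imp dF => t dFt ut tv; exists (- h t - - (h s - e)).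
      by have [] := hs t ut tv; lra.
    have dt := dFt (le_trans au ut).
    by apply: is_derive_eq; rewrite [_ *: _]mulr1.
  by rewrite ler_norml; apply/andP; split; lra.
exists d => // y ys; have ss : `|s - s| < d by rewrite subrr normr0.
have [sy|/ltW sy] := leP s y.
  by have := le_ _ _ sy ss ys; rewrite (@ger0_norm _ (y - s)) ?subr_ge0.
have := le_ _ _ sy ys ss; rewrite (@ler0_norm _ (y - s)) ?subr_le0// opprB.
by rewrite -normrN; congr (`|_| <= _); rewrite [_ *: _]/GRing.scale/=; ring.
Qed.

End AlmostEverywhereDerivative.
(** * Nonexpansive semi-flows *)

Section NonexpansiveSemiflow.
Context {R : realType} {N : nat}.
Implicit Types (x y z p q c : 'rV[R]_N).
Local Notation d := eucl_dist.

Variables (K : set 'rV[R]_N) (phi : R -> 'rV[R]_N -> 'rV[R]_N).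
Hypothesis Kcl : closed K.
Hypothesis Kcv : @convex_set R 'rV[R]_N K.
Hypothesis phiK : forall (t : R) x, 0 <= t -> K x -> K (phi t x).
Hypothesis phi0 : forall x, K x -> phi 0 x = x.
Hypothesis phiD : forall (t s : R) x, 0 <= t -> 0 <= s -> K x ->
  phi (t + s) x = phi t (phi s x).
Hypothesis phi_contr : forall (t : R) x y, 0 <= t -> K x -> K y ->
  d (phi t x) (phi t y) <= d x y.
Hypothesis phi_cont0 : forall x (e : R), K x -> 0 < e ->
  exists2 r : R, 0 < r & forall t : R, 0 <= t -> t < r -> d x (phi t x) < e.
Variable o : 'rV[R]_N.
Hypothesis oE : equilibria phi K o.

(** An intrinsic form of the omega-limit set, without an auxiliary orbit that accumulates at y; see
    [omega_limitE]. *)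
Definition recurrent : set 'rV[R]_N :=
  [set y | K y /\ forall e T : R, 0 < e -> 0 <= T ->
    exists2 t, T <= t & d y (phi t y) < e].

(** If the orbit of x is near y at times s1 and s2, then phi(s2 - s1) y is near phi(s2) x by
    nonexpansiveness, hence near y. *)
Lemma omega_limitE : omega_limit phi K = recurrent.
Proof.
apply/seteqP; split => [y [x Kx xy]|y [Ky ry]].
  split=> [|e T e0 T0]; first by have [] := xy 0 (lexx 0).
  have e20 : 0 < e / 2 by rewrite divr_gt0.
  have [_ /closure_euclP/(_ _ e20)[_ [s1 /= s10 <-] ys1]] := xy 0 (lexx 0).
  have s1T : 0 <= s1 + T by rewrite addr_ge0.
  have [_ /closure_euclP/(_ _ e20)[_ [s2 /= s12 <-] ys2]] := xy _ s1T.
  exists (s2 - s1); first by lra.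
  have s20 : 0 <= s2 - s1 by lra.
  apply: le_lt_trans (eucl_dist_triangle (phi s2 x) _ _) _.
  rewrite [ltRHS]splitr; apply: ltr_leD => //.
  have -> : phi s2 x = phi (s2 - s1) (phi s1 x) by rewrite -phiD// subrK.
  have [Ky _] := xy 0 (lexx 0).
  by apply: le_trans (phi_contr s20 (phiK s10 Kx) Ky) _; rewrite eucl_distC ltW.
exists y => // t /= t0; split => //; apply/closure_euclP => e e0.
by have [s ts ys] := ry e t e0 t0; exists (phi s y) => //; exists s.
Qed.

Lemma equilibrium_recurrent x : equilibria phi K x -> recurrent x.
Proof.
move=> [Kx xE]; split => // e T e0 T0; exists T => //.
by rewrite xE// eucl_distxx.
Qed.

Lemma phiC t s x : 0 <= t -> 0 <= s -> K x -> phi t (phi s x) = phi s (phi t x).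
Proof. by move=> t0 s0 Kx; rewrite -!phiD// addrC. Qed.

(** At a late return time u of y the point phi(t) y has returned as well, since phi(u) and phi(t)
    commute. The distance cannot grow between s and u, so it cannot have shrunk before s. *)
Lemma orbit_isometry y t s : recurrent y -> 0 <= t -> 0 <= s ->
  d (phi s y) (phi s (phi t y)) = d y (phi t y).
Proof.
move=> [Ky ry] t0 s0; apply/eqP; rewrite eq_le phi_contr//=; last exact: phiK.
apply/ler_addgt0Pr => e e0; have e20 : 0 < e / 2 by rewrite divr_gt0.
have [u su yu] := ry _ s e20 s0.
have u0 := le_trans s0 su.
apply: le_trans (eucl_dist_triangle (phi u y) _ _) _.
have := eucl_dist_triangle (phi u (phi t y)) (phi u y) (phi t y).
have : d (phi u (phi t y)) (phi t y) <= d y (phi u y).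
  rewrite phiC// (eucl_distC y); apply: phi_contr => //; exact: phiK.
have : d (phi u y) (phi u (phi t y)) <= d (phi s y) (phi s (phi t y)).
  have us : 0 <= u - s by rewrite subr_ge0.
  rewrite -(subrK s u) !(@phiD (u - s))//; last exact: phiK.
  by apply: phi_contr => //; do ?apply: phiK.
lra.
Qed.

Lemma orbit_bounded t x : 0 <= t -> K x -> d o (phi t x) <= d o x.
Proof.
by move=> t0 Kx; have [Ko oF] := oE; rewrite -[X in d X _](oF t t0) phi_contr.
Qed.

Lemma ball_compact r : compact (K `&` [set y | d o y <= r]).
Proof.
apply: (@bounded_eucl_compact _ _ _ o r) => [|y []//].
apply: closedI => //.
have := @closed_comp _ _ (eucl_dist o) [set s | s <= r].
apply; last exact: closed_le.
by move=> y _; exact: eucl_dist_continuous.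
Qed.

(** Compactness is applied to pairs so that a single index m serves both components. *)
Lemma seq_cluster (u : nat -> 'rV[R]_N * 'rV[R]_N) r :
  (forall n, [/\ K (u n).1, d o (u n).1 <= r, K (u n).2 & d o (u n).2 <= r]) ->
  exists2 p : 'rV[R]_N * 'rV[R]_N, K p.1 /\ K p.2 &
  forall (e : R) (n : nat), 0 < e ->
    exists2 m, (n <= m)%N & d p.1 (u m).1 < e /\ d p.2 (u m).2 < e.
Proof.
move=> hu; pose B := K `&` [set y | d o y <= r].
have cB : compact (B `*` B) by apply: compact_setX; exact: ball_compact.
have uB : (u @ \oo) (B `*` B).
  by exists 0%N => // n _; have [? ? ? ?] := hu n.
have [p [[[Kp1 _] [Kp2 _]] clp]] := cB (u @ \oo) _ uB.
exists p => // e n e0.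
have Un : (u @ \oo) [set u m | m in [set m | (n <= m)%N]].
  by exists n => // m /= nm; exists m.
have Vp : nbhs p [set q : 'rV[R]_N * 'rV[R]_N | d p.1 q.1 < e /\ d p.2 q.2 < e].
  exists ([set x | d p.1 x < e], [set x | d p.2 x < e]) => //=.
  by split; apply/nbhs_euclP; exists e.
have [_ [[m nm <-] [? ?]]] := clp _ _ Un Vp.
by exists m.
Qed.

(* Two terms of the bounded sequence of pairs (phi(nT') y, phi(nT') y') are close
   to each other; by isometry along orbits the lag between them is a return
   time of both points. *)
Lemma joint_recurrence y y' (e T : R) : recurrent y -> recurrent y' ->
  0 < e -> 0 <= T -> exists2 t, T <= t & d y (phi t y) < e /\ d y' (phi t y') < e.
Proof.
move=> ry ry' e0 T0; have [Ky _] := ry; have [Ky' _] := ry'.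
(* The step T + 1 is positive even for T = 0, and each of its positive multiples is at least T. *)
pose tau (n : nat) : R := n%:R * (T + 1).
have T1 : 0 < T + 1 by lra.
have tau0 n : 0 <= tau n by rewrite mulr_ge0// ltW.
pose u n := (phi (tau n) y, phi (tau n) y').
have [|p _ up] := @seq_cluster u (Num.max (d o y) (d o y')).
  by move=> n; split => /=; rewrite ?le_max ?orbit_bounded ?orbT//; exact: phiK.
have e20 : 0 < e / 2 by rewrite divr_gt0.
have [j _ [yj y'j]] := up (e / 2) 0%N e20.
have [l jl [yl y'l]] := up (e / 2) j.+1 e20.
have tjl : tau l = tau j + tau (l - j)%N.
  by rewrite /tau -mulrDl -natrD subnKC// ltnW.
have Tl : T <= tau (l - j)%N.
  rewrite /tau; have : 1 <= (l - j)%:R :> R by rewrite ler1n subn_gt0.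
  by nra.
exists (tau (l - j)%N) => //; split.
  rewrite -(orbit_isometry ry (tau0 _) (tau0 j)) -phiD// -tjl.
  apply: le_lt_trans (eucl_dist_triangle p.1 _ _) _.
  by rewrite [ltRHS]splitr ltrD// eucl_distC.
rewrite -(orbit_isometry ry' (tau0 _) (tau0 j)) -phiD// -tjl.
apply: le_lt_trans (eucl_dist_triangle p.2 _ _) _.
by rewrite [ltRHS]splitr ltrD// eucl_distC.
Qed.

(** Same argument as for [orbit_isometry], with a common return time of the two points. *)
Lemma recurrent_isometry y y' t : recurrent y -> recurrent y' -> 0 <= t ->
  d (phi t y) (phi t y') = d y y'.
Proof.
move=> ry ry' t0; have [Ky _] := ry; have [Ky' _] := ry'.
apply/eqP; rewrite eq_le phi_contr//=.
apply/ler_addgt0Pr => e e0; have e20 : 0 < e / 2 by rewrite divr_gt0.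
have [u tu [yu y'u]] := joint_recurrence ry ry' e20 t0.
have := eucl_dist_triangle (phi u y) y y'.
have := eucl_dist_triangle (phi u y') (phi u y) y'.
have : d (phi u y) (phi u y') <= d (phi t y) (phi t y').
  have ut : 0 <= u - t by rewrite subr_ge0.
  rewrite -(subrK t u) !(@phiD (u - t))//.
  by apply: phi_contr => //; apply: phiK.
rewrite (eucl_distC (phi u y') y'); lra.
Qed.

Lemma recurrent_phi y t : recurrent y -> 0 <= t -> recurrent (phi t y).
Proof.
move=> [Ky ry] t0; split; first exact: phiK.
move=> e T e0 T0; have [s Ts ys] := ry e T e0 T0; exists s => //.
have s0 := le_trans T0 Ts.
by rewrite phiC//; exact: le_lt_trans (phi_contr t0 Ky (phiK s0 Ky)) ys.
Qed.

Lemma recurrent_closed : closed recurrent.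
Proof.
apply: closed_euclP => x hx.
have Kx : K x.
  apply: Kcl; apply/closure_euclP => e e0.
  by have [y [Ky _] xy] := hx e e0; exists y.
split => // e T e0 T0; have e30 : 0 < e / 3 by rewrite divr_gt0.
have [y [Ky ry] xy] := hx _ e30.
have [t Tt yt] := ry _ T e30 T0; exists t => //.
have t0 := le_trans T0 Tt.
have := eucl_dist_triangle y x (phi t x).
have := eucl_dist_triangle (phi t y) y (phi t x).
have := phi_contr t0 Ky Kx; rewrite (eucl_distC y x); lra.
Qed.

(** For return times s_n of y, the points phi(s_n - t) y cluster at some p; applying phi(t) to them
    gives phi(s_n) y, which tends to y. *)
Lemma recurrent_surj y t : recurrent y -> 0 <= t ->
  exists2 p, recurrent p & phi t p = y.
Proof.
move=> ry t0; have [Ky hy] := ry.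
have hs n : exists s : R, t <= s /\ d y (phi s y) < n.+1%:R^-1.
  by have [|s ts ys] := hy n.+1%:R^-1 t _ t0; [rewrite invr_gt0|exists s].
have [s hs'] := choice hs.
pose u n := (phi (s n - t) y, phi (s n - t) y).
have st n : 0 <= s n - t by have [] := hs' n; rewrite subr_ge0.
have [|p [Kp _] up] := @seq_cluster u (d o y).
  by move=> n; split => /=; rewrite ?orbit_bounded//; exact: phiK.
exists p.1.
  apply: recurrent_closed; apply/closure_euclP => e e0.
  have [m _ [pm _]] := up e 0%N e0.
  by exists (phi (s m - t) y) => //; exact: recurrent_phi.
apply: eucl_dist_small_eq => e e0; have e20 : 0 < e / 2 by rewrite divr_gt0.
have [n en] : exists n : nat, n.+1%:R^-1 < e / 2.
  by have [n] := ltr_add_invr e20; rewrite add0r; exists n.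
have [m nm [pm _]] := up _ n e20.
apply: le_lt_trans (eucl_dist_triangle (phi (s m) y) _ _) _.
rewrite [ltRHS]splitr ltrD//.
  rewrite -{1}(subrKC t (s m)) phiD//.
  exact: le_lt_trans (phi_contr t0 Kp (phiK (st m) Ky)) pm.
rewrite eucl_distC; have [_ /lt_trans] := hs' m; apply.
by apply: le_lt_trans en; rewrite lef_pV2 ?posrE// ler_nat.
Qed.

(** The images of y and y' keep their distance, and the image of the combination gets no farther
    from them; [affine_combination_rigid] leaves it one position. *)
Lemma phi_conv y y' (l t : R) : recurrent y -> recurrent y' ->
  0 <= l -> l <= 1 -> 0 <= t ->
  phi t ((1 - l) *: y + l *: y') = (1 - l) *: phi t y + l *: phi t y'.
Proof.
move=> ry ry' l0 l1 t0; have [Ky _] := ry; have [Ky' _] := ry'.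
have Kq : K ((1 - l) *: y + l *: y') by exact: (convexP _).1.
apply: (@affine_combination_rigid _ _ l y y') => //.
- exact: recurrent_isometry.
- exact: phi_contr.
- exact: phi_contr.
Qed.

(** A common return time of y and y' serves every point between them, as phi(t) acts affinely
    there. *)
Lemma recurrent_convex : @convex_set R 'rV[R]_N recurrent.
Proof.
apply/convexP => y y' l l0 l1 ry ry'; have [Ky _] := ry; have [Ky' _] := ry'.
split; first exact: (convexP _).1.
move=> e T e0 T0; have [t Tt [yt y't]] := joint_recurrence ry ry' e0 T0.
exists t => //; rewrite phi_conv//; last exact: le_trans Tt.
rewrite /d.
have -> : (1 - l) *: y + l *: y' - ((1 - l) *: phi t y + l *: phi t y') =
  (1 - l) *: (y - phi t y) + l *: (y' - phi t y').
  by apply/rowP => i; rewrite !mxE; ring.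
apply: le_lt_trans (eucl_normD _ _) _; rewrite !eucl_normZ.
rewrite (ger0_norm l0) ger0_norm ?subr_ge0//.
rewrite -/(eucl_dist y _) -/(eucl_dist y' _).
have [l0'|l0'] := eqVneq l 0; first by rewrite l0' subr0 mul1r mul0r addr0.
have lgt : 0 < l by rewrite lt_neqAle eq_sym l0'.
have := ler_wpM2l (_ : 0 <= 1 - l) (ltW yt).
have := ltr_pM2l lgt (d y' (phi t y')) e; rewrite y't.
rewrite subr_ge0 => h1 /(_ l1) h2; lra.
Qed.

(** Choose A of maximal rank; a recurrent point outside the span of its rows would yield a matrix of
    larger rank. *)
Lemma recurrent_span : exists (k : nat) (A : 'M[R]_(k, N)),
  (forall i, recurrent (o + row i A)) /\
  (forall y, recurrent y -> (y - o <= A)%MS).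
Proof.
pose P r := `[< exists (k : nat) (A : 'M[R]_(k, N)),
  (forall i, recurrent (o + row i A)) /\ \rank A = r >].
have exP : exists r, P r.
  exists (\rank (0 : 'M[R]_(0, N))); apply/asboolP.
  by exists 0%N, 0; split => // -[].
have ubP r : P r -> (r <= N)%N.
  by move=> /asboolP[k [A [_ <-]]]; exact: rank_leq_col.
case: (ex_maxnP exP ubP) => r /asboolP[k [A [rA <-]]] hmax.
exists k, A; split => // y ry; apply: contraT => yA.
suff /hmax : P (\rank (col_mx (y - o) A)).
  suff : (\rank A < \rank (col_mx (y - o) A))%N by rewrite ltnNge => /negbTE ->.
  apply: rank_ltmx; rewrite ltmxE -!addsmxE addsmxSr /=.
  by apply: contra yA => h; apply: submx_trans h; exact: addsmxSl.
apply/asboolP; exists (1 + k)%N, (col_mx (y - o) A); split => // i.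
case: (split_ordP i) => j ->.
  by rewrite rowKu row_id subrKC.
by rewrite rowKd.
Qed.

(** The barycentre of o and the points o + row i A serves as q. Keeping y within distance 1 of o
    bounds its coefficients in the rows, so that one r suits all y even if the recurrent set is
    unbounded. *)
Lemma interior_recurrent : exists2 q, recurrent q & exists2 r : R, 0 < r &
  forall y, recurrent y -> d o y <= 1 -> recurrent (q + r *: (q - y)).
Proof.
have [k [A [rA spanA]]] := recurrent_span.
have ro := equilibrium_recurrent oE.
(* B bounds the coefficients of y - o in the rows of A, as the entries of y - o are at most 1 in
   absolute value. *)
pose B : R := \sum_j \sum_i `|pinvmx A j i|.
have B0 : 0 <= B by apply: sumr_ge0 => j _; exact: sumr_ge0.
have k0 : 0 < k.+1%:R :> R by [].
(* Chosen so that r (1 + (k+1) B) = 1 / (k+1): the weights (1 + r) / (k+1) - r a_i are then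
   nonnegative and of sum at most 1. *)
pose r : R := (k.+1%:R * (1 + k.+1%:R * B))^-1.
have den : 1 <= 1 + k.+1%:R * B by rewrite lerDl mulr_ge0.
have r0 : 0 < r by rewrite invr_gt0 mulr_gt0// (lt_le_trans ltr01).
have rB : r * (1 + k.+1%:R * B) = k.+1%:R^-1.
  by rewrite /r invfM -mulrA mulVf ?mulr1// gt_eqF// (lt_le_trans ltr01).
pose q := o + \sum_i k.+1%:R^-1 *: row i A.
have kk : \sum_(i < k) k.+1%:R^-1 = k%:R / k.+1%:R :> R.
  by rewrite sumr_const card_ord -[LHS]mulr_natl.
exists q.
  apply: (convex_combination recurrent_convex ro rA) => [i|].
    by rewrite invr_ge0.
  by rewrite kk ler_pdivrMr// mul1r ler_nat.
exists r => // y ry y1.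
pose a i := ((y - o) *m pinvmx A) 0 i.
have yE : y = o + \sum_i a i *: row i A.
  by rewrite -[LHS](subrKC o) -(mulmxKpV (spanA _ ry)) mulmx_sum_row.
have aB i : `|a i| <= B.
  rewrite /a mxE; apply: le_trans (ler_norm_sum _ _ _) _.
  apply: ler_sum => j _; rewrite normrM.
  apply: (@le_trans _ _ `|pinvmx A j i|).
    rewrite ler_piMl//; apply: le_trans (coord_le_norm _ _) _.
    apply: le_trans (le_norm_eucl _) _; rewrite -/(eucl_dist y o).
    by rewrite eucl_distC.
  by rewrite (bigD1 i)//= lerDl sumr_ge0.
have -> : q + r *: (q - y) = o + \sum_i ((1 + r) / k.+1%:R - r * a i) *: row i A.
  rewrite {1}yE /q opprD addrACA subrr add0r -sumrB scaler_sumr -addrA -big_split/=.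
  congr (_ + _); apply: eq_bigr => i _.
  by apply/rowP => j; rewrite !mxE; ring.
have kB : k%:R * B <= k.+1%:R * B by rewrite ler_wpM2r// ler_nat.
apply: (convex_combination recurrent_convex ro rA) => [i|].
  have := aB i; rewrite ler_norml => /andP[_ ai].
  have h1 : r * a i <= r * B by rewrite ler_pM2l.
  have : B <= 1 + k.+1%:R * B.
    by have : B <= k.+1%:R * B; [rewrite ler_peMl// ler1n|lra].
  rewrite -(ler_pM2l r0) rB => h2.
  have : 0 <= r / k.+1%:R by rewrite divr_ge0// ltW.
  rewrite mulrDl mul1r; move: (k.+1%:R^-1) h2 => v h2 h3.
  by move: (r * a i) (r * B) (r * v) h1 h2 h3 => ? ? ? ? ? ?; lra.
rewrite big_split/= sumrN -!mulr_sumr kk.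
have : \sum_(i < k) a i >= - (k%:R * B).
  apply: (@le_trans _ _ (\sum_(i < k) - B)).
    by rewrite sumr_const card_ord -[leRHS]mulr_natl mulrN.
  apply: ler_sum => i _; have := aB i; rewrite ler_norml => /andP[+ _].
  by rewrite lerNl.
rewrite -(ler_pM2l r0) => h1.
have kE : k%:R / k.+1%:R = 1 - k.+1%:R^-1 :> R.
  by rewrite -natr1; field; rewrite natr1.
rewrite kE.
have h3 : 0 <= r * k.+1%:R^-1 by apply: mulr_ge0; [exact: ltW|rewrite invr_ge0].
have h2 : r * (k%:R * B) <= r * (k.+1%:R * B) by rewrite ler_pM2l.
move: rB h1 h2 h3; rewrite mulrN; clear.
move: (k%:R * B) (k.+1%:R * B) (k.+1%:R^-1) (\sum_i a i) => z1 z2 v s.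
by move=> <- h1 h2 h3; lra.
Qed.

(* The set of relative interior points (at scale r) of the recurrent set is
   closed, convex and invariant, so its point nearest to the equilibrium o is
   again an equilibrium. *)
Lemma interior_equilibrium : exists2 c, equilibria phi K c &
  exists2 r : R, 0 < r &
    forall y, recurrent y -> d o y <= 1 -> recurrent (c + r *: (c - y)).
Proof.
have [q0 rq0 [r r0 q0r]] := interior_recurrent.
pose Q : set 'rV[R]_N := [set q | recurrent q /\
  forall y, recurrent y -> d o y <= 1 -> recurrent (q + r *: (q - y))].
have Q0 : Q !=set0 by exists q0.
have cQ : closed Q.
  apply: closed_euclP => x hx; split.
    apply: recurrent_closed; apply/closure_euclP => e e0.
    by have [y [ry _] xy] := hx e e0; exists y.
  move=> y ry oy; apply: recurrent_closed; apply/closure_euclP => e e0.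
  have r10 : 0 < 1 + r by lra.
  have er0 : 0 < e / (1 + r) by rewrite divr_gt0.
  have [z [rz zQ] xz] := hx _ er0.
  exists (z + r *: (z - y)); first exact: zQ.
  rewrite /d.
  have -> : x + r *: (x - y) - (z + r *: (z - y)) = (1 + r) *: (x - z).
    by apply/rowP => i; rewrite !mxE; ring.
  by rewrite eucl_normZ gtr0_norm// -ltr_pdivlMl// mulrC.
have vQ : @convex_set R 'rV[R]_N Q.
  have /convexP vr := recurrent_convex.
  apply/convexP => x y t t0 t1 [rx Qx] [ry Qy]; split; first exact: vr.
  move=> z rz oz.
  have -> : (1 - t) *: x + t *: y + r *: ((1 - t) *: x + t *: y - z) =
      (1 - t) *: (x + r *: (x - z)) + t *: (y + r *: (y - z)).
    by apply/rowP => i; rewrite !mxE; ring.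
  by apply: vr => //; [exact: Qx|exact: Qy].
have ro := equilibrium_recurrent oE.
have phiQ t q : 0 <= t -> Q q -> Q (phi t q).
  move=> t0 [rq Qq]; split; first exact: recurrent_phi.
  (* Here y = phi(t) p with p as near to o as y. As q lies between p and q', affinity of phi(t)
     sends q' to phi(t) q + r (phi(t) q - y). *)
  move=> y ry oy; have [p rp py] := recurrent_surj ry t0.
  have op : d o p <= 1.
    by rewrite -(recurrent_isometry ro rp t0) py (oE.2 t t0).
  have rq' := Qq p rp op; set q' := q + r *: (q - p) in rq'.
  have r10 : 1 + r != 0 by rewrite gt_eqF//; lra.
  have l0 : 0 <= r / (1 + r) by rewrite divr_ge0//; lra.
  have l1 : r / (1 + r) <= 1 by rewrite ler_pdivrMr; lra.
  have qE : q = (1 - r / (1 + r)) *: q' + (r / (1 + r)) *: p.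
    by apply/rowP => i; rewrite !mxE; field.
  have := phi_conv rq' rp l0 l1 t0; rewrite -qE py => phiE.
  have -> : phi t q + r *: (phi t q - y) = phi t q'.
    by rewrite phiE; apply/rowP => i; rewrite !mxE; field.
  exact: recurrent_phi.
have [Qc _] := proj_spec o cQ Q0; set c := proj Q o in Qc.
have [[Kc _] Qc2] := Qc.
exists c; last by exists r.
split=> // t t0; apply: proj_nearest => //; first exact: phiQ.
exact: orbit_bounded.
Qed.

Lemma recurrent_bij t : 0 <= t -> set_bij recurrent recurrent (phi t).
Proof.
move=> t0; split.
- by move=> x rx; exact: recurrent_phi.
- move=> x y; rewrite !inE => rx ry xy; apply: eucl_dist_eq0.
  by rewrite -(recurrent_isometry rx ry t0) xy eucl_distxx.
- by move=> y ry; have [p rp py] := recurrent_surj ry t0; exists p.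
Qed.

(** * Extension of the semi-flow to a group of isometries *)

Local Notation psi := (extend_flow phi recurrent).

Lemma extend_flow_recurrent t x : recurrent x -> recurrent (psi t x).
Proof.
rewrite /extend_flow; case: ifPn => t0 rx; first exact: recurrent_phi.
have t0' : 0 <= - t by rewrite oppr_ge0 ltW// ltNge.
have [_ _ surj] := recurrent_bij t0'.
by apply: (surjpinv_image_sub surj); exists x.
Qed.

(** Statements about psi reduce to phi after applying phi(T) with T large; phi(T) is an injective
    isometry on recurrent points, so nothing is lost. *)
Lemma phi_extend_flow T t x : recurrent x -> 0 <= T -> 0 <= T + t ->
  phi T (psi t x) = phi (T + t) x.
Proof.
move=> rx T0 Tt; have [Kx _] := rx.
rewrite /extend_flow; case: ifPn => t0; first by rewrite phiD.
have t0' : 0 <= - t by rewrite oppr_ge0 ltW// ltNge.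
have [_ _ surj] := recurrent_bij t0'.
have := extend_flow_recurrent t rx; rewrite /extend_flow (negbTE t0) => -[Kp _].
have phiE : phi (- t) (pinv recurrent (phi (- t)) x) = x.
  exact: (surjpK _ surj (mem_set rx)).
rewrite -[in RHS]phiE -phiD//.
by congr (phi _ _); ring.
Qed.

Lemma phi_inj t x y : recurrent x -> recurrent y -> 0 <= t ->
  phi t x = phi t y -> x = y.
Proof.
move=> rx ry t0 xy; have [_ inj _] := recurrent_bij t0.
by apply: inj => //; exact: mem_set.
Qed.

Lemma extend_flow0 x : recurrent x -> psi 0 x = x.
Proof. by move=> [Kx _]; rewrite /extend_flow lexx phi0. Qed.

Lemma extend_flowD t s x : recurrent x -> psi (t + s) x = psi t (psi s x).
Proof.
move=> rx; set T := `|t| + `|s|.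
have T0 : 0 <= T by rewrite addr_ge0.
have h1 := ler_norm (- t); have h2 := ler_norm (- s); rewrite !normrN in h1 h2.
have h3 := normr_ge0 t; have h4 := normr_ge0 s.
have rs := extend_flow_recurrent s rx.
apply: (phi_inj _ _ T0); do ?exact: extend_flow_recurrent.
rewrite !phi_extend_flow ?addrA// /T; lra.
Qed.

Lemma extend_flow_isometry t x y : recurrent x -> recurrent y ->
  d (psi t x) (psi t y) = d x y.
Proof.
move=> rx ry; have T0 := normr_ge0 t.
have Tt : 0 <= `|t| + t by have := ler_norm (- t); rewrite normrN; lra.
rewrite -(recurrent_isometry _ _ T0); do ?exact: extend_flow_recurrent.
by rewrite !phi_extend_flow// recurrent_isometry.
Qed.

(** The displacement depends only on the elapsed time, so right continuity of phi at time 0 gives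
    continuity of psi in time everywhere. *)
Lemma extend_flow_speed t s x : recurrent x ->
  d (psi t x) (psi s x) = d x (phi `|s - t| x).
Proof.
move=> rx; wlog ts : t s / t <= s.
  move=> h; have [|/ltW st] := leP t s; first exact: h.
  by rewrite eucl_distC h// distrC.
rewrite ger0_norm ?subr_ge0//.
have -> : psi s x = psi t (psi (s - t) x) by rewrite -extend_flowD// subrKC.
rewrite extend_flow_isometry//; last exact: extend_flow_recurrent.
by rewrite /extend_flow subr_ge0 ts.
Qed.

Lemma extend_flow_flow : flow psi recurrent.
Proof.
split.
- by move=> t x; exact: extend_flow_recurrent.
- apply/subspace_continuousP => -[s y] /= ry.
  apply/cvg_euclP => e e0; have e20 : 0 < e / 2 by rewrite divr_gt0.
  have [Ky _] := ry; have [r r0 yr] := phi_cont0 Ky e20.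
  rewrite near_withinE /=; exists ([set t | `|t - s| < r], [set x | d y x < e / 2]).
    split => /=; last by apply/nbhs_euclP; exists (e / 2).
    by exists r => //= t; rewrite /ball/= distrC.
  move=> [t x] /= [ts yx] rx.
  apply: le_lt_trans (eucl_dist_triangle (psi t y) _ _) _.
  rewrite [ltRHS]splitr ltrD//; last by rewrite extend_flow_isometry.
  by rewrite extend_flow_speed//; exact: yr.
- exact: extend_flow0.
- by move=> t s x; exact: extend_flowD.
Qed.

Lemma extend_flow_isometries : flow_of_isometries psi recurrent.
Proof.
split; first exact: extend_flow_flow.
move=> t; split; last by move=> x y; exact: extend_flow_isometry.
split.
- by move=> x; exact: extend_flow_recurrent.
- move=> x y; rewrite !inE => rx ry xy; apply: eucl_dist_eq0.
  by rewrite -(extend_flow_isometry t rx ry) xy eucl_distxx.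
- move=> y ry; exists (psi (- t) y); first exact: extend_flow_recurrent.
  by rewrite -extend_flowD// subrr extend_flow0.
Qed.

End NonexpansiveSemiflow.

(** * Faces *)

Section FaceOfPoint.
Context {R : realType} {N : nat}.
Implicit Types (x y z v c : 'rV[R]_N) (K F E : set 'rV[R]_N).

(** For K convex and c in K this is the smallest face through c, by [face_at_is_face] and
    [face_at_sub_face]. *)
Definition face_at K c : set 'rV[R]_N :=
  [set v | K v /\ exists2 r : R, 0 < r & K (c + r *: (c - v))].

Lemma affine_span_affine F : affine_set (affine_span F).
Proof. by move=> x y t Fx Fy W WF; apply: WF.1; [exact: Fx|exact: Fy]. Qed.

Lemma affine_span_sub F : F `<=` affine_span F.
Proof. by move=> x Fx W [_]; exact. Qed.

Lemma relint_extend F p v : relint F p -> F v ->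
  exists2 r : R, 0 < r & F (p + r *: (p - v)).
Proof.
move=> [Fp /nbhs_euclP[e e0 eF]] Fv.
have D0 : 0 < eucl_dist p v + 1 by rewrite ltr_wpDl ?eucl_dist_ge0.
exists (e / (eucl_dist p v + 1)); first by rewrite divr_gt0.
apply: eF.
  rewrite /eucl_dist opprD addNKr eucl_normN eucl_normZ gtr0_norm ?divr_gt0//.
  by rewrite mulrAC ltr_pdivrMr// ltr_pM2l// ltrDl.
have -> : p + (e / (eucl_dist p v + 1)) *: (p - v) =
    (1 - - (e / (eucl_dist p v + 1))) *: p + (- (e / (eucl_dist p v + 1))) *: v.
  by apply/rowP => i; rewrite !mxE; ring.
by apply: affine_span_affine; apply: affine_span_sub.
Qed.

(** The affine span lies in the line through x and y, where points of parameters l and t are |l - t|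
    |y - x| apart; closer than min(l, 1 - l) |y - x|, the parameter t stays in [0, 1]. *)
Lemma segment_relint x y (l : R) : 0 < l -> l < 1 ->
  relint (segment x y) ((1 - l) *: x + l *: y).
Proof.
move=> l0 l1.
have inseg t : 0 <= t -> t <= 1 -> segment x y ((1 - t) *: x + t *: y).
  by move=> t0 t1; exists t => //=; rewrite in_itv/= t0 t1.
split; first by apply: inseg; exact: ltW.
have span z : affine_span (segment x y) z ->
    exists t : R, z = (1 - t) *: x + t *: y.
  move=> /(_ [set z | exists t : R, z = (1 - t) *: x + t *: y]); apply.
  split=> [_ _ s [a ->] [b ->]|_ [t _ <-]]; last by exists t.
  by exists ((1 - s) * a + s * b); apply/rowP => i; rewrite !mxE; ring.
have [yx|yx] := eqVneq y x.
  apply/nbhs_euclP; exists 1 => // _ _ /span[t ->].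
  have := inseg 0 (lexx 0) ler01; congr (segment x y _).
  by rewrite yx -!scalerDl !subrK.
have D0 : 0 < eucl_norm (y - x).
  rewrite lt_neqAle eucl_norm_ge0 andbT eq_sym.
  by apply: contra_neq yx => /eucl_norm_eq0/eqP; rewrite subr_eq0 => /eqP.
apply/nbhs_euclP; exists (Num.min l (1 - l) * eucl_norm (y - x)).
  by rewrite mulr_gt0// lt_min l0 subr_gt0.
move=> z + /span[t zE]; rewrite zE /eucl_dist.
have -> : (1 - l) *: x + l *: y - ((1 - t) *: x + t *: y) = (l - t) *: (y - x).
  by apply/rowP => i; rewrite !mxE; ring.
rewrite eucl_normZ ltr_pM2r// lt_min !ltr_norml => /andP[/andP[? ?] /andP[? ?]].
by apply: inseg; lra.
Qed.

Lemma face_at_is_face K c : @convex_set R 'rV[R]_N K -> K c ->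
  is_face K (face_at K c).
Proof.
move=> /convexP vK Kc; split; first by move=> v [].
- apply/convexP => x y t t0 t1 [Kx [r r0 Kr]] [Ky [s s0 Ks]].
  split; first exact: vK.
  (* The prolongations for x and y may differ in length; both are shortened to the smaller factor,
     using convexity with c. *)
  have shrink (u w : R) z : 0 < w -> w <= u -> K (c + u *: (c - z)) ->
      K (c + w *: (c - z)).
    move=> w0 wu Ku; have u0 : 0 < u := lt_le_trans w0 wu.
    have -> : c + w *: (c - z) = (1 - w / u) *: c + (w / u) *: (c + u *: (c - z)).
      by apply/rowP => i; rewrite !mxE; field; rewrite gt_eqF.
    apply: vK => //; first by rewrite divr_ge0// ltW.
    by rewrite ler_pdivrMr// mul1r.
  pose w := Num.min r s; have w0 : 0 < w by rewrite lt_min r0.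
  have Kwx : K (c + w *: (c - x)) by apply: (shrink r); rewrite // ge_min lexx.
  have Kwy : K (c + w *: (c - y)) by apply: (shrink s); rewrite // ge_min lexx orbT.
  exists w => //; have := vK _ _ t t0 t1 Kwx Kwy; congr K.
  by apply/rowP => i; rewrite !mxE; ring.
- move=> x y xyK [p [pxy [Kp [r r0 Kr]]]] v vxy; split; first exact: xyK.
  have [s s0 ps] := relint_extend pxy vxy; have {}ps := xyK _ ps.
  (* c and p lie strictly between two points of K on the lines through p and v
     respectively, so the segment from v to c can be prolonged in K. *)
  pose S := 1 + r / (1 + s).
  have s1 : 0 < 1 + s by rewrite ltr_wpDr// ltW.
  have S0 : 0 < S by rewrite ltr_wpDr// divr_ge0 ?ltW.
  exists (r * s / (1 + s) / S); first by rewrite !divr_gt0// mulr_gt0.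
  have t0 : 0 <= r / (1 + s) / S by rewrite !divr_ge0 ?ltW.
  have t1 : r / (1 + s) / S <= 1 by rewrite ler_pdivrMr// mul1r /S; lra.
  have := vK _ _ _ t0 t1 Kr ps; congr K.
  apply/rowP => i; rewrite !mxE /S; field.
  by rewrite !gt_eqF//; lra.
Qed.

(** c is interior to the segment from x to its prolongation u beyond c, so a face through c contains
    the whole segment. *)
Lemma face_at_sub_face K F c : is_face K F -> @convex_set R 'rV[R]_N K -> F c ->
  face_at K c `<=` F.
Proof.
move=> [FK _ Fseg] /convexP vK Fc x [Kx [r r0 Ku]].
set u := c + r *: (c - x) in Ku.
have r1 : 0 < 1 + r by lra.
pose l := (1 + r)^-1.
have l0 : 0 < l by rewrite invr_gt0.
have l1 : l < 1 by rewrite invf_lt1//; lra.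
have cE : c = (1 - l) *: x + l *: u.
  by apply/rowP => i; rewrite /l !mxE; field; rewrite gt_eqF.
apply: (Fseg x u).
- move=> _ [t /= + <-]; rewrite in_itv/= => /andP[t0 t1]; exact: vK.
- by exists c; split => //; rewrite cE; exact: segment_relint.
- by exists 0; rewrite /= ?in_itv/= ?ler01 ?lexx// subr0 scale1r scale0r addr0.
Qed.

Lemma minimal_face_at K E c : @convex_set R 'rV[R]_N K -> K c -> E c ->
  E `<=` face_at K c -> minimal_face K E = face_at K c.
Proof.
move=> vK Kc Ec Eface; apply/seteqP; split.
  by move=> v; apply; split => //; exact: face_at_is_face.
by move=> v cv F [FK EF]; exact: (face_at_sub_face FK vK (EF _ Ec)).
Qed.

End FaceOfPoint.

(** * Normal cones and linear projections *)

Section LinearProjection.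
Context {R : realType} {N : nat}.
Implicit Types (x y z w : 'rV[R]_N) (W V : set 'rV[R]_N).

Lemma mulmxr_continuous (m n p : nat) (P : 'M[R]_(n, p)) :
  continuous (fun x : 'M[R]_(m, n) => x *m P).
Proof.
apply: (@bounded_linear_continuous R _ _ (mulmxr P)).
pose B : R := \sum_i \sum_j `|P i j|.
have B0 : 0 <= B by apply: sumr_ge0 => j _; exact: sumr_ge0.
rewrite /bounded_near; near=> M.
apply: (filterS _ (@nbhs0_le R 'M[R]_(m, n) 1 ltr01)) => x x1 /=.
apply: (@le_trans _ _ B).
  rewrite [leLHS]/Num.Def.normr/= mx_normrE (bigmax_le _ B0)//= => -[i j] _ /=.
  rewrite mxE; apply: le_trans (ler_norm_sum _ _ _) _.
  apply: ler_sum => k _; rewrite normrM.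
  apply: (@le_trans _ _ `|P k j|).
    rewrite ler_piMl//; apply: le_trans x1.
    rewrite [leRHS]/Num.Def.normr/= mx_normrE.
    exact: (le_bigmax _ (fun ij : 'I_m * 'I_n => `|x ij.1 ij.2|) (i, k)).
  by rewrite (bigD1 j)//= lerDl sumr_ge0.
by near: M; apply: nbhs_pinfty_ge; exact: num_real.
Unshelve. all: by end_near. Qed.

(** Testing the obtuse angle condition at proj x + w and proj x - w makes x - proj x orthogonal to
    W. Linearity follows by uniqueness of the projection, and the rows of P are the projections of
    the basis vectors. *)
Lemma proj_linear W : closed W -> W 0 ->
  (forall (a : R) x y, W x -> W y -> W (a *: x + y)) ->
  exists P : 'M[R]_N, forall x, proj W x = x *m P.
Proof.
move=> cW W0 linW.
have vW : @convex_set R 'rV[R]_N W.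
  apply/convexP => x y t _ _ Wx Wy; apply: (linW _ _ _ Wx).
  by rewrite -[_ *: y]addr0; exact: linW.
have W00 : W !=set0 by exists 0.
have Wp x : W (proj W x) by have [] := proj_spec x cW W00.
have orth x w : W w -> dot (x - proj W x) w = 0.
  move=> Ww; apply/eqP; rewrite eq_le; apply/andP; split.
    have := proj_dot_le x cW vW W00 (linW 1 _ _ Ww (Wp x)).
    by rewrite scale1r addrK.
  have := proj_dot_le x cW vW W00 (linW (-1) _ _ Ww (Wp x)).
  by rewrite scaleN1r addrK dotNr oppr_le0.
have projD (a : R) x y : proj W (a *: x + y) = a *: proj W x + proj W y.
  apply: proj_unique; first exact: linW.
  move=> q Wq; have -> : a *: x + y - (a *: proj W x + proj W y) =
    a *: (x - proj W x) + (y - proj W y) by apply/rowP => i; rewrite !mxE; ring.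
  have Wd : W (q - (a *: proj W x + proj W y)).
    by rewrite -scaleN1r addrC; apply: (linW _ _ _ _ Wq); apply: linW.
  by rewrite dotDl dotZl !orth// mulr0 addr0.
exists (\matrix_(i, j) proj W (delta_mx 0 i) 0 j) => x.
rewrite mulmx_sum_row {1}[x]row_sum_delta.
have proj0 : proj W 0 = 0.
  by have := projD (-1) 0 0; rewrite scaler0 addr0 scaleN1r addNr.
elim/big_ind2 : _ => [//|x1 x2 y1 y2 <- <-|i _].
  by rewrite -[x2 in LHS]scale1r projD scale1r.
rewrite -[X in proj W X]addr0 projD proj0 addr0; congr (_ *: _).
by apply/rowP => j; rewrite !mxE.
Qed.

Lemma C1_on_mulmxr W (f : 'rV[R]_N -> 'rV[R]_N) (P : 'M[R]_N) :
  C1_on W f -> C1_on W (fun z => f z *m P).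
Proof.
move=> [U [h [oU WU hf dh ch]]].
have cP (m : nat) := @mulmxr_continuous m N N P.
have dP y : differentiable (mulmxr P : 'rV[R]_N -> 'rV[R]_N) y.
  by apply: linear_differentiable; exact: cP.
exists U, (mulmxr P \o h); split; [exact: oU|exact: WU| | |].
- by move=> x xW; rewrite /= hf.
- by move=> x Ux; apply: differentiable_comp; [exact: dh|exact: dP].
- move=> x Ux.
  (* Row i of a jacobian is the image of the i-th basis vector, so composing h with right
     multiplication by P multiplies its jacobian by P on the right. *)
  have rowJ (k : 'rV[R]_N -> 'rV[R]_N) y i :
      row i (jacobian k y) = 'd k y (delta_mx 0 i).
    by rewrite rowE mul_rV_lin1.
  have E y : U y -> jacobian (mulmxr P \o h) y = jacobian h y *m P.
    move=> Uy; apply/row_matrixP => i.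
    rewrite (rowJ (mulmxr P \o h)).
    rewrite [RHS]row_mul.
    rewrite (rowJ h).
    have dE := diff_comp (dh _ Uy) (dP (h y)).
    have lE := @diff_lin R _ _ (mulmxr P) (h y) (cP 1%N).
    apply: etrans (congr1 (fun k => k _) dE) _.
    exact: (congr1 (fun k => k _) lE).
  change (jacobian (mulmxr P \o h) @ x --> jacobian (mulmxr P \o h) x).
  rewrite (E _ Ux).
  apply: (@cvg_trans _ ((fun y => jacobian h y *m P) @ nbhs x)).
    apply: (@near_eq_cvg _ _ (nbhs x) (nbhs_filter x)).
    have nU : nbhs x U by exact: open_nbhs_nbhs.
    apply: (filterS _ nU).
    by move=> y Uy; rewrite (E _ Uy).
  exact: (cvg_comp _ _ (ch x Ux) (cP _ _)).
Qed.

Lemma normal_cone_closed W z : closed (normal_cone W z).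
Proof.
apply: closed_euclP => x hx y Wy; rewrite leNgt; apply/negP => h.
set v := y - z in h *.
have v1 : 0 < eucl_norm v + 1 by rewrite ltr_wpDl ?eucl_norm_ge0.
have e0 : 0 < dot x v / (eucl_norm v + 1) by rewrite divr_gt0.
have [w nw] := hx _ e0; rewrite ltr_pdivlMr// => xw.
have := nw y Wy; rewrite -/v => wv.
have := cauchy_schwarz (x - w) v; rewrite dotDl dotNl.
have := eucl_norm_ge0 v; have := eucl_norm_ge0 (x - w).
move: xw; rewrite /eucl_dist; nra.
Qed.

Lemma normal_cone0 W z : normal_cone W z 0.
Proof. by move=> w _; rewrite dot0l. Qed.

(** V contains the reflection of v through c, so the defining inequality holds with both signs: N_V
    is the orthogonal complement of the directions of V. *)
Lemma normal_cone_affineP V c w : affine_set V -> V c ->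
  normal_cone V c w <-> forall v, V v -> dot w (v - c) = 0.
Proof.
move=> aV Vc; split=> [nw v Vv|h v Vv]; last by rewrite h.
apply/eqP; rewrite eq_le nw//=.
have := nw _ (aV c v (-1) Vc Vv).
have -> : (1 - -1) *: c + -1 *: v - c = - (v - c).
  by apply/rowP => i; rewrite !mxE; ring.
by rewrite dotNr oppr_le0.
Qed.

Lemma normal_cone_affine_linear V c : affine_set V -> V c ->
  forall (a : R) x y, normal_cone V c x -> normal_cone V c y ->
  normal_cone V c (a *: x + y).
Proof.
move=> aV Vc a x y /(normal_cone_affineP _ aV Vc) nx.
move=> /(normal_cone_affineP _ aV Vc) ny; apply/normal_cone_affineP => // v Vv.
by rewrite dotDl dotZl nx// ny// mulr0 addr0.
Qed.

(** N_V is a closed linear subspace, so the field is f times the constant matrix 1 - P. *)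
Lemma C1_on_affine_projected_field W V (f : 'rV[R]_N -> 'rV[R]_N) :
  affine_set V -> V !=set0 -> C1_on W f -> C1_on W (affine_projected_field V f).
Proof.
move=> aV [c Vc] C1f; rewrite /affine_projected_field (normal_cone_affE aV Vc).
have [P hP] := proj_linear (@normal_cone_closed V c) (@normal_cone0 V c)
  (normal_cone_affine_linear aV Vc).
have -> : (fun z => f z - proj (normal_cone V c) (f z)) =
    (fun z => f z *m (1%:M - P)).
  by apply/funext => z; rewrite hP mulmxBr mulmx1.
exact: C1_on_mulmxr.
Qed.

End LinearProjection.

(** * Absolutely continuous curves *)

Section AbsolutelyContinuousCurves.
Context {R : realType} {N : nat}.
Implicit Types (z w : R -> 'rV[R]_N) (a b : R).

Lemma abs_continuous_unif a b z : abs_continuous a b z ->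
  forall e : R, 0 < e -> exists2 r : R, 0 < r & forall u v, a <= u -> u <= v ->
    v <= b -> v - u < r -> eucl_dist (z v) (z u) < e.
Proof.
move=> acz e e0; have [r r0 rz] := acz e e0; exists r => // u v au uv vb uvr.
have := rz 1%N (fun=> u) (fun=> v); rewrite !big_ord1; apply => //.
by apply/trivIsetP => i j _ _; rewrite !ord1 eqxx.
Qed.

Lemma abs_continuous_cvg a b z t : abs_continuous a b z -> a < t < b ->
  z s @[s --> t] --> z t.
Proof.
move=> acz /andP[at_ tb]; apply/cvg_euclP => e e0.
have [r r0 rz] := abs_continuous_unif acz e0.
exists (Num.min r (Num.min (t - a) (b - t))).
  by rewrite /= !lt_min r0 !subr_gt0 at_ tb.
move=> s; rewrite /ball_/= !lt_min !ltr_norml.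
move=> /and3P[/andP[s1 s2] /andP[s3 s4] /andP[s5 s6]].
have [ts|/ltW st] := leP t s.
  by rewrite eucl_distC; apply: rz => //; lra.
by apply: rz => //; lra.
Qed.

Lemma abs_continuous_bounded a b z : a <= b -> abs_continuous a b z ->
  exists2 M : R, 0 <= M & forall t, a <= t -> t <= b -> eucl_norm (z t) <= M.
Proof.
move=> ab acz; have [r r0 rz] := abs_continuous_unif acz ltr01.
pose nz t := eucl_dist 0 (z t).
have tri s t : nz s <= nz t + eucl_dist (z t) (z s).
  exact: eucl_dist_triangle.
have cz : {within `[a, b], continuous nz}.
  apply/subspace_continuousP => t /=; rewrite in_itv/= => /andP[at_ tb].
  apply/cvgrPdist_lt => e e0.
  have {r r0 rz}[r r0 rz] := abs_continuous_unif acz e0.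
  rewrite near_withinE; exists r => //= s; rewrite /ball_/= => tsr.
  rewrite in_itv/= => /andP[as_ sb].
  have ts : eucl_dist (z t) (z s) < e.
    move: tsr; rewrite ltr_norml => /andP[? ?].
    have [ts|/ltW st] := leP t s; last by apply: rz => //; lra.
    by rewrite eucl_distC; apply: rz => //; lra.
  have := tri s t; have := tri t s; rewrite (eucl_distC (z s)).
  move=> h1 h2; suff : `|nz t - nz s| < e by [].
  by rewrite ltr_norml; apply/andP; split; lra.
have [c _ hc] := EVT_max ab cz.
exists (nz c); first exact: eucl_dist_ge0.
move=> t at_ tb; have := hc t; rewrite in_itv/= at_ tb => /(_ isT).
by rewrite {1}/nz /eucl_dist sub0r eucl_normN.
Qed.

Lemma abs_continuous_fun_le a b z w (F : R -> R) (C : R) :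
  (forall u v, a <= u -> u <= v -> v <= b ->
    `|F v - F u| <= C * (eucl_dist (z v) (z u) + eucl_dist (w v) (w u))) ->
  abs_continuous a b z -> abs_continuous a b w -> abs_continuous_fun a b F.
Proof.
move=> FC acz acw e e0.
have C1 : 0 < 2 * (`|C| + 1) by rewrite mulr_gt0// ltr_wpDl.
have e'0 : 0 < e / (2 * (`|C| + 1)) by rewrite divr_gt0.
have [r r0 rz] := acz _ e'0; have [s s0 sw] := acw _ e'0.
exists (Num.min r s); first by rewrite lt_min r0.
move=> k u v uv tuv; rewrite lt_min => /andP[sr ss].
have := rz k u v uv tuv sr; have := sw k u v uv tuv ss.
set Z := (X in _ -> X < _ -> _); set W := (X in X < _ -> _) => W1 Z1.
apply: (@le_lt_trans _ _ ((`|C| + 1) * (Z + W))).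
  rewrite -big_split/= mulr_sumr; apply: ler_sum => i _.
  have [aui uvi vib] := uv i; apply: le_trans (FC _ _ aui uvi vib) _.
  rewrite ler_wpM2r ?addr_ge0 ?eucl_dist_ge0//.
  by rewrite (le_trans (ler_norm C))// lerDl.
have C2 : 0 < `|C| + 1 by rewrite ltr_wpDl.
rewrite -ltr_pdivlMl//; apply: lt_le_trans (ltrD Z1 W1) _.
rewrite le_eqVlt; apply/orP; left; apply/eqP; field.
by rewrite gt_eqF.
Qed.

Lemma abs_continuous_coord a b z i : abs_continuous a b z ->
  abs_continuous_fun a b (fun t => z t 0 i).
Proof.
move=> acz; apply: (abs_continuous_fun_le (C := 1) _ acz acz) => u v _ _ _.
rewrite mul1r ler_wpDr ?eucl_dist_ge0//.
have -> : z v 0 i - z u 0 i = (z v - z u) 0 i by rewrite !mxE.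
exact: le_trans (coord_le_norm _ _) (le_norm_eucl _).
Qed.

(** |p|^2 - |q|^2 = (p + q).(p - q), and p + q is bounded because both curves are bounded on
    [a, b]. *)
Lemma abs_continuous_sqr_dist a b z w : a <= b ->
  abs_continuous a b z -> abs_continuous a b w ->
  abs_continuous_fun a b (fun t => dot (z t - w t) (z t - w t)).
Proof.
move=> ab acz acw; have [M M0 zM] := abs_continuous_bounded ab acz.
have [L L0 wL] := abs_continuous_bounded ab acw.
apply: (abs_continuous_fun_le (C := 2 * (M + L)) _ acz acw) => u v au uv vb.
have nb t : a <= t -> t <= b -> eucl_norm (z t - w t) <= M + L.
  move=> at_ tb; apply: le_trans (eucl_normD _ _) _.
  by rewrite eucl_normN lerD ?zM ?wL.
set p := z v - w v; set q := z u - w u.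
have pq : eucl_norm (p - q) <= eucl_dist (z v) (z u) + eucl_dist (w v) (w u).
  rewrite /eucl_dist -[eucl_norm (w v - w u)]eucl_normN.
  apply: le_trans (eucl_normD _ _); rewrite le_eqVlt; apply/orP; left.
  by apply/eqP; congr eucl_norm; apply/rowP => i; rewrite !mxE; ring.
have pMq : eucl_norm (p + q) <= 2 * (M + L).
  have := nb v (le_trans au uv) vb; have := nb u au (le_trans uv vb).
  by have := eucl_normD p q; rewrite -/p -/q; lra.
have E (x y : 'rV[R]_N) : dot x x - dot y y = dot (x + y) (x - y).
  by rewrite !dot_lin (dotC y x); ring.
rewrite E; apply: (@le_trans _ _ (eucl_norm (p + q) * eucl_norm (p - q))).
  rewrite ler_norml lerNl -dotNr cauchy_schwarz andbT.
  by rewrite -[eucl_norm (p - q)]eucl_normN cauchy_schwarz.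
by rewrite ler_pM ?eucl_norm_ge0.
Qed.

Lemma is_derive_coordP (t : R) z (l : 'rV[R]_N) :
  is_derive t 1 z l <-> forall i, is_derive t 1 (fun s => z s 0 i) (l 0 i).
Proof.
split=> [[dz <-] i|dz].
  have dzi := (derivable_mxP z t 1).1 dz.
  by apply: DeriveDef; [exact: dzi|rewrite derive_mx// mxE].
have dz' : derivable z t 1.
  by apply/derivable_mxP => i j; rewrite ord1; have [] := dz j.
apply: DeriveDef => //; rewrite derive_mx//; apply/rowP => i.
by rewrite mxE; have [] := dz i.
Qed.

Lemma is_derive_dot (t : R) z w (l m : 'rV[R]_N) :
  is_derive t 1 z l -> is_derive t 1 w m ->
  is_derive t 1 (fun s => dot (z s) (w s)) (dot l (w t) + dot (z t) m).
Proof.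
move=> /is_derive_coordP dz /is_derive_coordP dw.
have -> : (fun s => dot (z s) (w s)) =
    \sum_(i < N) ((fun s => z s 0 i) * (fun s => w s 0 i)).
  by apply/funext => s; rewrite dotE fct_sumE.
have -> : dot l (w t) + dot (z t) m =
    \sum_(i < N) (z t 0 i *: m 0 i + w t 0 i *: l 0 i).
  rewrite !dotE -big_split/=; apply: eq_bigr => i _.
  by rewrite addrC [l 0 i * _]mulrC.
by apply: is_derive_sum => i; exact: is_deriveM.
Qed.

(** Testing the derivative on an increment to the right stays within the nonnegative times, where F
    is known. *)
Lemma is_derive_cst_right (V : normedModType R) (F : R -> V) (t : R) (k l : V) :
  0 < t -> (forall s, 0 <= s -> F s = k) -> is_derive t 1 F l -> l = 0.
Proof.
move=> t0 Fk /is_derive_approx dF; apply/eqP; rewrite -normr_le0.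
apply/ler_addgt0Pr => e e0; rewrite add0r.
have [r r0 rF] := dF e e0; have r20 : 0 < r / 2 by rewrite divr_gt0.
have := rF (t + r / 2); rewrite [t + _ - t]addrAC subrr add0r gtr0_norm//.
have tr : r / 2 < r by lra.
have E1 : F (t + r / 2) = k by apply: Fk; rewrite addr_ge0// ltW.
have E2 : F t = k by apply: Fk; rewrite ltW.
move=> /(_ tr); rewrite E1 E2 (subrr k) sub0r normrN normrZ gtr0_norm//.
by rewrite [e * _]mulrC ler_pM2l.
Qed.

End AbsolutelyContinuousCurves.

(** * The projected dynamics *)

Section ProjectedDynamics.
Context {R : realType} {N : nat}.
Variables (K : set 'rV[R]_N) (f : 'rV[R]_N -> 'rV[R]_N).
Variable phi : R -> 'rV[R]_N -> 'rV[R]_N.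
Hypothesis Kcl : closed K.
Hypothesis Kcv : @convex_set R 'rV[R]_N K.
Hypothesis C1f : C1_on K f.
Hypothesis f_mono : forall z w, K z -> K w -> dot (f z - f w) (z - w) <= 0.
Hypothesis phi_sf : semi_flow phi K.
Hypothesis phi_sol : forall x, K x ->
  caratheodory_solution K (projected_field K f) (phi ^~ x).
Local Notation mu := (@lebesgue_measure R).
Local Notation n z := (proj (normal_cone K z) (f z)).
Local Notation Omega := (recurrent K phi).

Lemma proj_normal_cone z : normal_cone K z (n z).
Proof.
have [] := proj_spec (f z) (@normal_cone_closed _ _ K z) _ => //.
by exists 0; exact: normal_cone0.
Qed.

(** The squared distance has nonpositive derivative almost everywhere: f contributes a nonpositive
    term by dissipativity, and so does each of the two normal vectors, because the other point lies
    in K. *)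
Lemma phi_contraction t x y : 0 <= t -> K x -> K y ->
  eucl_dist (phi t x) (phi t y) <= eucl_dist x y.
Proof.
move=> t0 Kx Ky; have [Kxs acx dx] := phi_sol Kx; have [Kys acy dy] := phi_sol Ky.
pose F s := dot (phi s x - phi s y) (phi s x - phi s y).
have : F t <= F 0.
  apply: (ae_derive_le0_nonincreasing t0).
    exact: (abs_continuous_sqr_dist t0 (acx _ t0) (acy _ t0)).
  apply: ae_imp (ae_and dx dy) => s [dxs dys] s0 _.
  have {}dxs := dxs s0; have {}dys := dys s0.
  have dq := is_deriveB dxs dys; have := is_derive_dot dq dq.
  set l := (X in is_derive _ _ _ X) => dF; exists l => //; rewrite /l.
  set zx := phi s x; set zy := phi s y.
  have -> : ((phi^~ x) - (phi^~ y)) s = zx - zy by [].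
  rewrite (dotC (zx - zy)) /projected_field.
  have := f_mono (Kxs s s0) (Kys s s0); rewrite -/zx -/zy.
  have := proj_normal_cone zx (Kys s s0); rewrite -/zx -/zy.
  have := proj_normal_cone zy (Kxs s s0); rewrite -/zx -/zy.
  have -> : zy - zx = - (zx - zy) by rewrite opprB.
  move: (zx - zy) (n zx) (n zy) (f zx) (f zy) => d nx ny fx fy.
  by rewrite !dot_lin; lra.
by rewrite /F !(semi_flow0 phi_sf)// eucl_norm_leP.
Qed.

Lemma phi_continuous0 x (e : R) : K x -> 0 < e ->
  exists2 r : R, 0 < r & forall t, 0 <= t -> t < r -> eucl_dist x (phi t x) < e.
Proof.
move=> Kx e0; have [_ acx _] := phi_sol Kx.
have [r r0 rx] := abs_continuous_unif (acx 1 ler01) e0.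
exists (Num.min r 1); first by rewrite lt_min r0/=.
move=> t t0; rewrite lt_min => /andP[tr t1].
have := rx 0 t (lexx 0) t0 (ltW t1); rewrite subr0 => /(_ tr).
by rewrite (semi_flow0 phi_sf)// eucl_distC.
Qed.

(** The constant orbit has zero velocity, and the equation holds at some time in ]0, 1[; so f c
    equals its projection onto the normal cone. *)
Lemma equilibrium_normal_cone c : equilibria phi K c -> normal_cone K c (f c).
Proof.
move=> [Kc cE]; have [_ _ dc] := phi_sol Kc.
have [t /andP[t0 _] dt] := ae_exists_itv (@ltr01 R) dc.
have := is_derive_cst_right t0 cE (dt (ltW t0)).
rewrite cE ?ltW// => /eqP; rewrite subr_eq0 => /eqP ->.
exact: proj_normal_cone.
Qed.

(** * The vector field on the omega-limit set *)

Variable o : 'rV[R]_N.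
Hypothesis oE : equilibria phi K o.
Local Notation F := (minimal_face K (equilibria phi K)).
Local Notation V := (affine_span F).
Local Notation g := (affine_projected_field V f).

(** A point strictly between o and y and within distance 1 of o lies in [face_at K c] by the choice
    of c, and drags the segment [o, y] into that face. Equilibria lie in Omega, so [minimal_face_at]
    applies. *)
Lemma interior_equilibrium_face : exists2 c, equilibria phi K c &
  F = face_at K c /\ Omega `<=` F.
Proof.
have [c cE [r r0 rc]] := interior_equilibrium Kcl Kcv (semi_flow_fun phi_sf)
  (semi_flowD phi_sf) phi_contraction oE.
have Kc := cE.1.
have Oface : Omega `<=` face_at K c.
  move=> y ry; have [Ky _] := ry.
  have D0 : 0 < eucl_dist o y + 2 by rewrite ltr_wpDl ?eucl_dist_ge0.
  (* The 2 makes l < 1 even if y = o, while l |o - y| <= 1. *)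
  pose l := (eucl_dist o y + 2)^-1.
  have l0 : 0 < l by rewrite invr_gt0.
  have l1 : l < 1 by rewrite invf_lt1//; have := eucl_dist_ge0 o y; lra.
  have ro : Omega o := equilibrium_recurrent oE.
  have vO := recurrent_convex Kcl Kcv (semi_flow_fun phi_sf) (semi_flowD phi_sf)
    phi_contraction oE.
  have rl : Omega ((1 - l) *: o + l *: y).
    by apply: (convexP _).1 => //; exact: ltW.
  have ol : eucl_dist o ((1 - l) *: o + l *: y) <= 1.
    rewrite /eucl_dist.
    have -> : o - ((1 - l) *: o + l *: y) = l *: (o - y).
      by apply/rowP => i; rewrite !mxE; ring.
    rewrite eucl_normZ gtr0_norm// -/(eucl_dist o y) ler_pdivrMl// mulr1.
    by rewrite lerDl.
  have [Kp _] := rc _ rl ol.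
  have [_ _ faceE] := face_at_is_face Kcv Kc; apply: (faceE o y).
  - move=> _ [t /= + <-]; rewrite in_itv/= => /andP[t0 t1].
    by apply: (convexP _).1 => //; exact: oE.1.
  - exists ((1 - l) *: o + l *: y); split; last by split; [exact: rl.1|exists r].
    exact: segment_relint.
  - by exists 1; rewrite /= ?in_itv/= ?ler01 ?lexx// subrr scale0r add0r scale1r.
exists c => //; have FE : F = face_at K c.
  apply: minimal_face_at => // y yE; apply: Oface; exact: equilibrium_recurrent.
by rewrite FE.
Qed.

Lemma C1_on_face_field : C1_on K g.
Proof.
apply: C1_on_affine_projected_field => //; first exact: affine_span_affine.
by exists o; apply: affine_span_sub => W [_]; exact.
Qed.

Lemma ae_projected_field_face x : Omega x ->
  {ae mu, forall t : R, 0 < t -> is_derive t 1 (phi ^~ x) (g (phi t x))}.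
Proof.
move=> rx; have [c cE [FE OF]] := interior_equilibrium_face.
have [Kx _] := rx; have [Kc cfix] := cE; have [_ _ dx] := phi_sol Kx.
have rc : Omega c := equilibrium_recurrent cE.
have aV : affine_set V by exact: affine_span_affine.
have Fc : F c by move=> W [_]; exact.
have Vc : V c by exact: affine_span_sub.
have Ot (s : R) : 0 <= s -> Omega (phi s x).
  exact: (recurrent_phi (semi_flow_fun phi_sf) (semi_flowD phi_sf)
    phi_contraction rx).
have cdist (s : R) : 0 <= s ->
    dot (phi s x - c) (phi s x - c) = dot (x - c) (x - c).
  move=> s0; rewrite -!sqr_eucl_norm -!/(eucl_dist _ _) -{1}(cfix s s0).
  by rewrite (recurrent_isometry Kcl (semi_flow_fun phi_sf)
    (semi_flowD phi_sf) phi_contraction oE rx rc s0).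
apply: ae_imp dx => t dxt t0; have {}dxt := dxt (ltW t0).
have rt := Ot t (ltW t0); have [Kt _] := rt.
have nt := proj_normal_cone (phi t x).
rewrite [X in is_derive _ _ _ X](_ : _ = projected_field K f (phi t x))//.
rewrite /affine_projected_field /projected_field; congr (_ - _).
rewrite (normal_cone_affE aV Vc).
set z := phi t x in dxt rt Kt nt *.
(* As |z - c| is constant, f z and n z have the same product with z - c. It is nonpositive by
   dissipativity and [equilibrium_normal_cone], and nonnegative since n z is normal at z. *)
have nzc : dot (n z) (z - c) = 0.
  have dq := is_deriveB dxt (is_derive_cst c t 1).
  have := is_derive_cst_right t0 cdist (is_derive_dot dq dq).
  have -> : (phi^~ x - cst c) t = z - c by [].
  rewrite (dotC (z - c)) subr0 /projected_field.
  have := f_mono Kt Kc; have := equilibrium_normal_cone cE Kt.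
  have := nt c Kc; have -> : c - z = - (z - c) by rewrite opprB.
  move: (z - c) (n z) (f z) (f c) => d nz fz fc.
  by rewrite !dot_lin; lra.
(* For w in F both w and its prolongation beyond c lie in K; as n z is orthogonal to z - c,
   normality at these two points gives n z.(w - c) = 0. This equation defines an affine set
   containing F, hence V. *)
have nV : normal_cone V c (n z).
  apply/normal_cone_affineP => // v.
  move=> /(_ [set v | dot (n z) (v - c) = 0]); apply; split.
    move=> p q s /= hp hq.
    have -> : (1 - s) *: p + s *: q - c = (1 - s) *: (p - c) + s *: (q - c).
      by apply/rowP => i; rewrite !mxE; ring.
    by rewrite dotDr !dotZr hp hq !mulr0 addr0.
  rewrite FE => w [Kw [r r0 Kr]] /=.
  have := nt _ Kw; have := nt _ Kr.
  have -> : c + r *: (c - w) - z = - (z - c) - r *: (w - c).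
    by apply/rowP => i; rewrite !mxE; ring.
  have -> : w - z = (w - c) - (z - c) by rewrite opprB addrA subrK.
  move: (z - c) (w - c) nzc => p q np.
  rewrite !dotDr !dotNr dotZr np => h1 h2.
  apply/eqP; rewrite eq_le; apply/andP; split; first lra.
  by rewrite -(pmulr_rge0 _ r0); lra.
(* The orbit stays in Omega, hence in V, so its velocity is orthogonal to N_V. *)
have pV w : normal_cone V c w -> dot (f z - n z) w = 0.
  move=> /(normal_cone_affineP _ aV Vc) wV.
  have wcst (s : R) : 0 <= s -> dot (phi s x) w = dot c w.
    move=> s0; apply/eqP; rewrite -subr_eq0 -dotNl -dotDl dotC.
    by apply/eqP/wV; apply: affine_span_sub; apply: OF; exact: Ot.
  have := is_derive_cst_right t0 wcst (is_derive_dot dxt (is_derive_cst w t 1)).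
  by rewrite dot0r addr0.
apply: proj_unique => // q qV.
by rewrite dotDr dotNr !pV// subr0.
Qed.

Lemma phi_derive x (s : R) : Omega x -> 0 < s ->
  is_derive s 1 (phi ^~ x) (g (phi s x)).
Proof.
move=> rx s0; have [Kx _] := rx; have [Kxt acx _] := phi_sol Kx.
(* [C1_on] supplies a map h that agrees with g on K and is continuous at points of K in the whole
   space, not only along K. *)
have [U [h [oU KU hg dh _]]] := C1_on_face_field.
have hgE t : 0 <= t -> h (phi t x) = g (phi t x).
  by move=> t0; apply/hg/mem_set/Kxt.
rewrite -hgE ?ltW//; apply/is_derive_coordP => i.
have s10 : 0 <= s + 1 by lra.
have s2s : s / 2 < s < s + 1 by apply/andP; split; lra.
(* The left endpoint s / 2 is positive, as the almost everywhere equation requires. *)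
apply: (@ae_derive_continuous_is_derive R _ (fun t => h (phi t x) 0 i)
  (s / 2) (s + 1)) => //.
- apply: (abs_continuous_fun_sub (a := 0) (b := s + 1)) => //; first lra.
  exact: (abs_continuous_coord i (acx _ s10)).
- apply: ae_imp (ae_projected_field_face rx) => t dt t2.
  have t0 : 0 < t by lra.
  rewrite hgE ?ltW//.
  by have /is_derive_coordP := dt t0; exact.
- have cphi : phi t x @[t --> s] --> phi s x.
    by apply: (abs_continuous_cvg (acx _ s10)); rewrite s0 ltrDl ltr01.
  have ch : {for phi s x, continuous h}.
    by apply: differentiable_continuous; apply: dh; apply/KU/Kxt; exact: ltW.
  exact: (cvg_comp _ _ (cvg_comp _ _ cphi ch) (@coord_continuous R 1 N 0 i _)).
Qed.

(** Starting the orbit at y = psi(-T) x with T = |t| + 1 moves time t to t + T >= 1, so that near t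
    psi is a time shift of phi and [phi_derive] applies. *)
Lemma extend_flow_derive x (t : R) : Omega x ->
  is_derive t 1 (extend_flow phi Omega ^~ x) (g (extend_flow phi Omega t x)).
Proof.
move=> rx; set psi := extend_flow phi Omega.
have phiK := semi_flow_fun phi_sf; have phiD := semi_flowD phi_sf.
pose T := `|t| + 1; pose y := psi (- T) x.
have ry : Omega y.
  exact: (extend_flow_recurrent Kcl phiK phiD phi_contraction oE).
have tT : 1 <= t + T.
  by have := ler_norm (- t); rewrite normrN /T; lra.
have psiE s : 0 <= s + T -> psi s x = phi (s + T) y.
  move=> sT; have -> : phi (s + T) y = psi (s + T) y.
    by rewrite /psi /extend_flow sT.
  rewrite /y /psi -(extend_flowD Kcl phiK phiD phi_contraction oE)//.
  by rewrite addrK.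
have tT0 : 0 < t + T by lra.
rewrite psiE ?ltW//; apply/is_derive_approx => e e0.
have /is_derive_approx/(_ e e0)[r r0 rF] := phi_derive ry tT0.
exists (Num.min r 1); first by rewrite lt_min r0/=.
move=> s; rewrite lt_min => /andP[sr s1].
have sT : 0 <= s + T by move: s1; rewrite ltr_norml => /andP[]; lra.
rewrite !psiE//; last exact: ltW.
have := rF (s + T); have -> : s + T - (t + T) = s - t by ring.
exact.
Qed.

End ProjectedDynamics.

Theorem theorem23 (R : realType) (n m : nat) (K : set 'rV[R]_(n + m))
    (f : 'rV[R]_(n + m) -> 'rV[R]_(n + m))
    (phi : R -> 'rV[R]_(n + m) -> 'rV[R]_(n + m)) :
  K !=set0 -> closed K -> @convex_set R 'rV[R]_(n + m) K ->
  C1_on K f ->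
  (forall z w, K z -> K w -> dot (f z - f w) (z - w) <= 0) ->
  semi_flow phi K ->
  (forall x, K x -> caratheodory_solution K (projected_field K f) (phi ^~ x)) ->
  equilibria phi K !=set0 ->
  let Omega := omega_limit phi K in
  let psi := extend_flow phi Omega in
  let V := affine_span (minimal_face K (equilibria phi K)) in
  let g := affine_projected_field V f in
  [/\ defines_flow phi Omega,
      flow_of_isometries psi Omega,
      (forall x, Omega x -> forall t : R,
         is_derive t 1 (psi ^~ x) (g (psi t x))) &
      C1_on K g].
Proof.
move=> _ Kcl Kcv C1f f_mono phi_sf phi_sol [] o oE Omega psi V g.
have phiK := semi_flow_fun phi_sf; have phiD := semi_flowD phi_sf.
have phi0 := semi_flow0 phi_sf.
have contr := phi_contraction f_mono phi_sf phi_sol.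
have cont0 := phi_continuous0 phi_sf phi_sol.
have OmegaE : omega_limit phi K = recurrent K phi by exact: omega_limitE.
rewrite /psi /Omega OmegaE.
have isom := extend_flow_isometries Kcl phiK phi0 phiD contr cont0 oE.
split.
- split; last exact: isom.1.
  by move=> t; exact: (recurrent_bij Kcl phiK phiD contr oE).
- exact: isom.
- by move=> x rx t; exact: (extend_flow_derive Kcl Kcv C1f f_mono phi_sf phi_sol oE).
- exact: (C1_on_face_field C1f oE).
Qed.
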